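(* Let $\mathcal{H}(x,y)\in\mathfrak{F}_1\cup\mathfrak{F}_2\cup\mathfrak{F}_3$ be a primitive polynomial with trivial global monodromy in normal form and let $\vartheta$ be a polynomial 1-form on $\mathbb{C}^2_{xy}$. Let $\mathcal{R}=(\mathcal{G},\mathcal{H})$ be the rational rectifying map for $\mathcal{H}$ and let $\eta=\mathcal{R}_*(\vartheta)$. 1) The corresponding infinitesimally perturbed Hamiltonian differential equations are rationally equivalent, that is, $\mathcal{R}_*(d\mathcal{H}+\varepsilon\vartheta)=d\mathfrak{c}+\varepsilon\eta$. 2) The Abelian integrals $\mathcal{I}(\mathfrak{c})=\int_{\delta(\mathfrak{c})}\vartheta:\mathbb{C}\setminus\mathfrak{B}(\mathcal{H})\to\mathbb{C}$ and $J(\mathfrak{c})=\int_{\alpha(\mathfrak{c})}\eta:\mathbb{C}\setminus\mathfrak{B}(\mathcal{H})\to\mathbb{C}$, where $\alpha(\mathfrak{c})=\mathcal{R}(\delta(\mathfrak{c}))$, are rationally equivalent; moreover $\mathcal{I}(\mathfrak{c})=J(\mathfrak{c})$ for all $\mathfrak{c}\in\mathbb{C}\setminus\mathfrak{B}(\mathcal{H})$. 3) The numbers of isolated zeros, counted with multiplicities, of $\mathcal{I}(\mathfrak{c})$ and of $J(\mathfrak{c})$ in $\mathbb{C}\setminus\mathfrak{B}(\mathcal{H})$ are the same: $Z(\mathcal{I}(\mathfrak{c}))=Z(J(\mathfrak{c}))$.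
   Context: Neumann–Norbury families (normal forms of primitive polynomials with trivial global monodromy): $\mathfrak{F}_1$ consists of $\mathcal{H}=x^{q_1}\mathcal{S}^q+x^{p_1}\mathcal{S}^p\prod_{i=1}^{r-1}(\beta_i-x^{q_1}\mathcal{S}^q)^{a_i}$ with $r\ge2$; $\mathfrak{F}_2$ of $\mathcal{H}=x^{p_1}\mathcal{S}^p\prod_{i=1}^{r-1}(\beta_i-x^{q_1}\mathcal{S}^q)^{a_i}$ with $r\ge1$; $\mathfrak{F}_3$ of $\mathcal{H}=y\prod_{i=1}^{r-1}(\beta_i-x)^{a_i}+h(x)$ with $r\ge1$; here $a_i$ are positive integers, $\beta_i$ distinct points of $\mathbb{C}^*$, $\deg h<\sum_i a_i$, $0\le p_1<p$, $0\le q_1<q$, $pq_1-qp_1=\pm1$, $\mathcal{S}(x,y)=x^ky+P(x)$, $k\ge1$, $P\in\mathbb{C}[x]$ with $\deg P\le k-1$. Rectifying map: $\mathcal{R}=(\mathcal{G},\mathcal{H}):\mathbb{C}^2_{xy}\to\mathbb{C}^2_{t\mathfrak{c}}$ with $\mathcal{G}=x^{q_1}\mathcal{S}^q$ for $\mathfrak{F}_1,\mathfrak{F}_2$ and $\mathcal{G}=x$ for $\mathfrak{F}_3$; it is birational, and biholomorphic from the complement of its ramification locus $\Sigma(\mathcal{R})=\{\mathcal{G}_x\mathcal{H}_y-\mathcal{G}_y\mathcal{H}_x=0\}$ onto the complement of an algebraic subset of $\mathbb{C}^2_{t\mathfrak{c}}$. $\mathcal{R}_*=(\mathcal{R}^{-1})^*$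 on forms, so $\eta$ is a rational 1-form. $\mathfrak{B}(\mathcal{H})$ is the bifurcation set (smallest finite set outside of which $\mathcal{H}$ is a locally trivial smooth fibration). $\{\delta(\mathfrak{c})\}$ is a family of cycles, $\delta(\mathfrak{c})$ being a non-contractible closed loop in the generic fiber $\{\mathcal{H}=\mathfrak{c}\}$, obtained by continuous transport over all generic values $\mathfrak{c}$. $Z(\cdot)$ denotes the number of isolated zeros in $\mathbb{C}\setminus\mathfrak{B}(\mathcal{H})$, counted with multiplicities.
   Formalization: In 2) and 3) the value c=0 is excluded for the second family with r=1, p=1 (H=S): there R contracts the fiber {H=0} to the origin, where η may have a pole, so J(0) can be undefined (e.g. H=xy+1, q=2, ϑ=y dx). *)

(* Defs.v *)
(* MathComp-Analysis; the complex plane is [R[i]] over a [realType] R.        *)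
From HB Require Import structures.
From mathcomp Require Import all_boot all_order all_algebra.
From mathcomp Require Import fraction generic_quotient complex.
From mathcomp Require Import all_classical all_reals all_analysis.
From mathcomp Require Import -(notations) mpoly.

Set Implicit Arguments.
Unset Strict Implicit.
Unset Printing Implicit Defensive.

Import Order.TTheory GRing.Theory Num.Theory.
Import numFieldNormedType.Exports.

Local Open Scope classical_set_scope.
Local Open Scope ring_scope.

(* The explicit target type selects the topological and normed structures that
   MathComp-Analysis attaches to an abstract numClosedFieldType. *)
Definition Cplx (R : realType) : numClosedFieldType := R[i].

Notation plane R := 'rV[Cplx R]_2.
Notation bipoly R := (mpoly 2 (Cplx R)).
Notation birat R := {fraction (bipoly R)}.
(* Rational maps C^2 --> C^2 and rational 1-forms on C^2, by components;
   (f_0, f_1) as a form is f_0 dX_0 + f_1 dX_1. *)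
Notation ratmap R := 'rV[birat R]_2.
Notation ratform R := 'rV[birat R]_2.

Section Algebra.
Variable R : realType.
Local Notation C := (Cplx R).

(* Index 0 is x (resp. t), index 1 is y (resp. the value coordinate c). *)
Definition var (i : 'I_2) : bipoly R := mpolyX C (mnm1 i).

Definition const (c : C) : bipoly R := mpolyC 2 c.

Definition poly_in_x (P : {poly C}) : bipoly R := (map_poly const P).[var 0].

Definition peval (p : bipoly R) (v : plane R) : C := meval (v 0) p.

Definition numer (f : birat R) : bipoly R := (frac (repr f)).1.
Definition denom (f : birat R) : bipoly R := (frac (repr f)).2.

(* Partial derivative of a rational function, by the quotient rule. *)
Definition rderiv (i : 'I_2) (f : birat R) : birat R :=
  tofrac (mderiv i (numer f) * denom f - numer f * mderiv i (denom f))
  / tofrac (denom f ^+ 2).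

(* f o Phi.  The value is meaningful when the denominator of f does not vanish
   identically on the image of Phi, e.g. when Phi is dominant. *)
Definition psubst (Phi : ratmap R) (p : bipoly R) : birat R :=
  mmap (fun c => tofrac (const c)) (Phi 0) p.
Definition rsubst (Phi : ratmap R) (f : birat R) : birat R :=
  psubst Phi (numer f) / psubst Phi (denom f).

Definition ratcomp (Psi Phi : ratmap R) : ratmap R := map_mx (rsubst Phi) Psi.

Definition ratid : ratmap R := \row_i tofrac (var i).

Definition is_ratinv (Phi Psi : ratmap R) : Prop :=
  ratcomp Phi Psi = ratid /\ ratcomp Psi Phi = ratid.

Definition birational (Phi : ratmap R) : Prop := exists Psi, is_ratinv Phi Psi.

Definition ratinv (Phi : ratmap R) : ratmap R := xget 0 (is_ratinv Phi).

Definition differential (f : birat R) : ratform R := \row_j rderiv j f.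

Definition form_pullback (Phi : ratmap R) (w : ratform R) : ratform R :=
  \sum_i rsubst Phi (w 0 i) *: differential (Phi 0 i).

Definition form_pushforward (Phi : ratmap R) (w : ratform R) : ratform R :=
  form_pullback (ratinv Phi) w.

(* f is regular at v when some fraction representing f has a denominator which
   does not vanish at v; the value is then independent of that fraction.  The
   fraction (numer f, denom f) need not be reduced, hence this definition. *)
Definition rvalue_at (f : birat R) (v : plane R) (z : C) : Prop :=
  exists n d : bipoly R,
    [/\ peval d v != 0, f = tofrac n / tofrac d & z = peval n v / peval d v].

Definition regular_at (f : birat R) (v : plane R) : Prop :=
  exists z, rvalue_at f v z.

Definition rvalue (f : birat R) (v : plane R) : C := xget 0 (rvalue_at f v).

Definition all_regular_at (Phi : 'rV[birat R]_2) (v : plane R) : Prop :=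
  forall i, regular_at (Phi 0 i) v.

Definition map_value (Phi : ratmap R) (v : plane R) : plane R :=
  \row_i rvalue (Phi 0 i) v.

End Algebra.

(** Normal forms *)

(* NF1 and NF2 take r p q p1 q1 k P beta a, and NF3 takes r beta a h.  The index
   i = 1, ..., r-1 of the beta_i and a_i is shifted to 0, ..., r-2. *)
Inductive normal_form (R : realType) : Type :=
| NF1 (r p q p1 q1 k : nat) (P : {poly (Cplx R)})
    (beta : 'I_r.-1 -> Cplx R) (a : 'I_r.-1 -> nat)
| NF2 (r p q p1 q1 k : nat) (P : {poly (Cplx R)})
    (beta : 'I_r.-1 -> Cplx R) (a : 'I_r.-1 -> nat)
| NF3 (r : nat) (beta : 'I_r.-1 -> Cplx R) (a : 'I_r.-1 -> nat)
    (h : {poly (Cplx R)}).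

Section NormalForms.
Variable R : realType.
Local Notation C := (Cplx R).

(* S = x^k y + P(x) *)
Definition skeleton (k : nat) (P : {poly C}) : bipoly R :=
  var R 0 ^+ k * var R 1 + poly_in_x P.

Definition xS (k : nat) (P : {poly C}) (m n : nat) : bipoly R :=
  var R 0 ^+ m * skeleton k P ^+ n.

Definition beta_prod (n : nat) (beta : 'I_n -> C) (a : 'I_n -> nat)
    (g : bipoly R) : bipoly R :=
  \prod_(i < n) (const (beta i) - g) ^+ a i.

Definition nf_G (nf : normal_form R) : bipoly R :=
  match nf with
  | NF1 _ p q p1 q1 k P _ _ => xS k P q1 q
  | NF2 _ p q p1 q1 k P _ _ => xS k P q1 q
  | NF3 _ _ _ _ => var R 0
  end.

Definition nf_H (nf : normal_form R) : bipoly R :=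
  match nf with
  | NF1 _ p q p1 q1 k P beta a =>
      xS k P q1 q + xS k P p1 p * beta_prod beta a (xS k P q1 q)
  | NF2 _ p q p1 q1 k P beta a =>
      xS k P p1 p * beta_prod beta a (xS k P q1 q)
  | NF3 _ beta a h =>
      var R 1 * beta_prod beta a (var R 0) + poly_in_x h
  end.

Definition beta_ok (n : nat) (beta : 'I_n -> C) (a : 'I_n -> nat) : Prop :=
  [/\ injective beta, forall i, beta i != 0 & forall i, (0 < a i)%N].

Definition exponents_ok (p q p1 q1 : nat) : Prop :=
  [/\ (p1 < p)%N, (q1 < q)%N
    & (p * q1)%:Z - (q * p1)%:Z = 1 \/ (p * q1)%:Z - (q * p1)%:Z = -1].

(* [size] is the degree plus one, and 0 for the zero polynomial. *)
Definition nf_ok (nf : normal_form R) : Prop :=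
  match nf with
  | NF1 r p q p1 q1 k P beta a =>
      [/\ (2 <= r)%N, beta_ok beta a, exponents_ok p q p1 q1, (1 <= k)%N
        & (size P <= k)%N]
  | NF2 r p q p1 q1 k P beta a =>
      [/\ (1 <= r)%N, beta_ok beta a, exponents_ok p q p1 q1, (1 <= k)%N
        & (size P <= k)%N]
  | NF3 r beta a h =>
      [/\ (1 <= r)%N, beta_ok beta a & (size h <= \sum_i a i)%N]
  end.

Definition rectifying_map (nf : normal_form R) : ratmap R :=
  \row_i tofrac (if i == 0 then nf_G nf else nf_H nf).

(* For H = S = x^k y + P(x) (second family, r = p = 1, hence p1 = 0, q1 = 1 and
   q >= 2), the map R = (x S^q, S) contracts the whole fiber {H = 0} to the
   origin, although 0 is a bifurcation value only when P(0) = 0.  When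
   P(0) <> 0, J(0) is then not defined: for H = x y + 1, q = 2 and the form
   y dx one finds eta = (c-1) dt/t - 2(c-1)/c dc, which has a pole at the point
   (0,0) to which the cycle of {H = 0} is sent.  In all other cases a fiber
   meeting the ramification locus of R lies over a bifurcation value. *)
Definition contracted_values (nf : normal_form R) : set C :=
  match nf with
  | NF2 r p _ _ _ _ _ _ _ => [set c | [/\ r = 1%N, p = 1%N & c = 0]]
  | _ => set0
  end.

End NormalForms.

(** Bifurcation set *)

Section Bifurcation.
Variable R : realType.
Local Notation C := (Cplx R).

Definition real_coords (n : nat) (v : 'rV[C]_n) : 'rV[R]_(n + n) :=
  row_mx (map_mx (@complex.Re R) v) (map_mx (@complex.Im R) v).

Fixpoint class_C (k m n : nat) (W : set 'rV[R]_m) (f : 'rV[R]_m -> 'rV[R]_n)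
    : Prop :=
  (forall x, W x -> {for x, continuous f}) /\
  match k with
  | 0%N => True
  | k'.+1 => forall v, (forall x, W x -> derivable f x v) /\
                       class_C k' W (fun x => 'D_v f x)
  end.

(* Smoothness, in the real sense, of a map on an arbitrary subset A of C^m:
   local extendability to a C^oo map of real coordinates. *)
Definition smooth_on (m n : nat) (A : set 'rV[C]_m) (f : 'rV[C]_m -> 'rV[C]_n)
    : Prop :=
  forall a, A a ->
    exists (W : set 'rV[R]_(m + m)) (F : 'rV[R]_(m + m) -> 'rV[R]_(n + n)),
      [/\ open W, W (real_coords a), forall k, class_C k W F
        & forall x, A x -> W (real_coords x) ->
            F (real_coords x) = real_coords (f x)].

Definition fiber (H : bipoly R) (c : C) : set (plane R) :=
  [set v | peval H v = c].

(* A pair (c, w) in C x C^2 *)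
Definition cpair (c : C) (w : plane R) : 'rV[C]_(1 + 2) := row_mx c%:M w.

(* v |-> (H v, pi v) is a diffeomorphism of H^-1(U) onto U x H^-1(c0), with
   inverse psi. *)
Definition smoothly_trivial_over (H : bipoly R) (c0 : C) (U : set C) : Prop :=
  exists (pi : plane R -> plane R) (psi : 'rV[C]_(1 + 2) -> plane R),
    [/\ forall v, U (peval H v) ->
          fiber H c0 (pi v) /\ psi (cpair (peval H v) (pi v)) = v,
        forall c w, U c -> fiber H c0 w ->
          fiber H c (psi (cpair c w)) /\ pi (psi (cpair c w)) = w,
        smooth_on [set v | U (peval H v)] pi
      & smooth_on [set z | exists c w, [/\ U c, fiber H c0 w & z = cpair c w]]
          psi].

Definition smooth_fibration_outside (H : bipoly R) (A : set C) : Prop :=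
  forall c0, ~ A c0 ->
    exists U : set C, [/\ open U, U c0 & smoothly_trivial_over H c0 U].

Definition bifurcation_set (H : bipoly R) : set C :=
  smallest (fun A => finite_set A /\ smooth_fibration_outside H A) set0.

End Bifurcation.

(** Cycles, integrals and zeros *)

Section Cycles.
Variable R : realType.
Local Notation C := (Cplx R).

Definition C1 (u : R -> R) : Prop :=
  (forall s, derivable u s 1) /\ continuous (derive1 u).

Definition C1_curve (g : R -> plane R) : Prop :=
  forall j, C1 (fun s => complex.Re (g s 0 j)) /\
            C1 (fun s => complex.Im (g s 0 j)).

(* Curves are parametrized by [0, 1]; values outside are irrelevant. *)
Definition piecewise_C1 (g : R -> plane R) : Prop :=
  exists s : seq R, itv_partition 0 1 s /\
    forall i, (i < size s)%N ->
      exists2 h, C1_curve h &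
        forall x, nth 0 (0 :: s) i <= x <= nth 0 s i -> g x = h x.

Definition closed_loop_in (F : set (plane R)) (g : R -> plane R) : Prop :=
  [/\ piecewise_C1 g, g 0 = g 1 & forall s, 0 <= s <= 1 -> F (g s)].

(* Continuous transport, through loops Gamma(u, -) in the fibers
   {H = gamma(u)}, of the loop g0 to the loop g1. *)
Definition transports (H : bipoly R) (gamma : R -> C) (g0 g1 : R -> plane R)
    : Prop :=
  exists Gamma : R * R -> plane R,
    [/\ {within `[0, 1] `*` `[0, 1], continuous Gamma},
        forall u s, 0 <= u <= 1 -> 0 <= s <= 1 -> fiber H (gamma u) (Gamma (u, s)),
        forall u, 0 <= u <= 1 -> Gamma (u, 0) = Gamma (u, 1)
      & forall s, 0 <= s <= 1 -> Gamma (0, s) = g0 s /\ Gamma (1, s) = g1 s].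

Definition contractible_in_fiber (H : bipoly R) (c : C) (g : R -> plane R)
    : Prop :=
  exists p : plane R, transports H (fun=> c) g (fun=> p).

(* Generic values are those outside the bifurcation set.  The loop transported
   along gamma is delta at the end point up to free homotopy in the fiber, the
   homotopy being absorbed in Gamma. *)
Definition family_of_cycles (H : bipoly R) (delta : C -> R -> plane R)
    : Prop :=
  let generic := ~` bifurcation_set H in
  (forall c, generic c ->
     closed_loop_in (fiber H c) (delta c) /\
     ~ contractible_in_fiber H c (delta c)) /\
  (forall gamma : R -> C, {within `[0, 1], continuous gamma} ->
     (forall u, 0 <= u <= 1 -> generic (gamma u)) ->
     transports H gamma (delta (gamma 0)) (delta (gamma 1))).

Definition curve_derivative (f : R -> C) (s : R) : C :=
  Complex (derive1 (fun s => complex.Re (f s)) s)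
          (derive1 (fun s => complex.Im (f s)) s).

Definition integral01 (f : R -> C) : C :=
  Complex (\int[lebesgue_measure]_(s in `[0, 1]) complex.Re (f s))
          (\int[lebesgue_measure]_(s in `[0, 1]) complex.Im (f s)).

Definition line_integral (g : R -> plane R) (w : ratform R) : C :=
  integral01 (fun s =>
    \sum_j rvalue (w 0 j) (g s) * curve_derivative (fun s => g s 0 j) s).

(* The Abelian integrals of w1 over the cycles delta1(c) in {H1 = c}, and of w2
   over the cycles delta2(c) in {H2 = c}, c in D, are rationally equivalent: a
   birational map, biregular along the cycles, carries one to the other. *)
Definition rationally_equivalent_integrals (D : set C)
    (H1 : bipoly R) (delta1 : C -> R -> plane R) (w1 : ratform R)
    (H2 : bipoly R) (delta2 : C -> R -> plane R) (w2 : ratform R) : Prop :=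
  exists Phi : ratmap R,
    [/\ birational Phi,
        rsubst Phi (tofrac H2) = tofrac H1,
        form_pushforward Phi w1 = w2
      & forall c s, D c -> 0 <= s <= 1 ->
          [/\ all_regular_at Phi (delta1 c s),
              delta2 c s = map_value Phi (delta1 c s)
            & all_regular_at (ratinv Phi) (delta2 c s)]].

Definition isolated_zero (D : set C) (f : C -> C) (z : C) : Prop :=
  [/\ D z, f z = 0 & \forall w \near z^', D w -> f w != 0].

Definition zero_of_order (D : set C) (f : C -> C) (z : C) (n : nat) : Prop :=
  exists g : C -> C,
    [/\ \forall w \near z, derivable g w 1, g z != 0
      & \forall w \near z, D w -> f w = (w - z) ^+ n * g w].

Definition multiplicity (D : set C) (f : C -> C) (z : C) : nat :=
  xget 0%N (zero_of_order D f z).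

(* Number, possibly infinite, of isolated zeros of f in D, with multiplicity *)
Definition zero_count (D : set C) (f : C -> C) : \bar R :=
  esum [set z | isolated_zero D f z]
    (fun z => ((multiplicity D f z)%:R : R)%:E).

End Cycles.

(* Main.v *)
(* The map (x, S) |-> (x^q1 S^q, x^p1 S^p) is monomial with determinant +-1 in
   the exponents, so R = (G, H) is inverted by explicit formulas, which are
   regular at R(v) as soon as v is good: x, S and all beta_i - G are nonzero
   at v (all beta_i - x for the third family).

   If {H = c} contains a point which is not good, one of x, S, beta_i - G divides
   H - c, say H - c = A B, and both A and B have zeros (except when H = S and
   c = 0, the contracted value).  The fibers over all but finitely many values
   are parametrized by t = G in the complement of a finite set, hence path
   connected.  If H were trivial near c, then {AB = 0} would be path connected
   too, so A and B would have a common zero, a critical point of H on {H = c},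
   which contradicts triviality.  Hence over a generic value all points are good,
   and the rest is the chain rule for R^-1 along the cycles. *)
Require Import Defs.
From HB Require Import structures.
From mathcomp Require Import all_boot all_order all_algebra.
From mathcomp Require Import fraction complex.
From mathcomp Require Import all_classical all_reals all_analysis.
From mathcomp Require Import -(notations) mpoly.
From mathcomp Require Import generic_quotient measurable_realfun ring zify.

Set Implicit Arguments.
Unset Strict Implicit.
Unset Printing Implicit Defensive.

Import Order.TTheory GRing.Theory Num.Theory.
Import numFieldNormedType.Exports.
Local Open Scope classical_set_scope.
Local Open Scope ring_scope.

(** * Rational functions, substitution and derivation *)

(** The same formulas are needed at points, with values in [C], and as identities between rational
    functions. They are therefore written once over an arbitrary field, and a [field_relation]
    carries them from one reading to the other. Several definitions rest on an arbitrary choice: the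
    representative behind [numer] and [denom], the inverse [ratinv], the value [rvalue]. Each choice
    has to be shown harmless before anything is computed, and for [rsubst] this asks the map to be
    dominant; dominance of the rectifying map and of its inverse is itself deduced from the explicit
    formulas. Triviality of the fibration is a smooth statement in real coordinates, so the
    geometric part works with paths from the real line: a curve lifting a real segment of values,
    and an intermediate value argument along a path between two points of a fiber. *)

Section Substitution.
Variable R : realType.
Local Notation C := (Cplx R).

HB.instance Definition _ := GRing.RMorphism.copy (@const R) (@mpolyC 2 C).

Definition ratconst (c : C) : birat R := tofrac (const c).
HB.instance Definition _ :=
  GRing.RMorphism.copy ratconst (@FracField.tofrac (bipoly R) \o @const R).

(** Chain rules, continuity and evaluation are all stable under sums and products, so this induction
    spares any later work with monomials. *)
Lemma bipoly_ind (P : bipoly R -> Prop) :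
  (forall c, P (const c)) -> (forall i, P (var R i)) ->
  (forall p q, P p -> P q -> P (p + q)) ->
  (forall p q, P p -> P q -> P (p * q)) -> forall p, P p.
Proof.
move=> Pc Pv PD PM; elim/mpolyind => [|c m p _ _ Pp].
  by have <- := rmorph0 (@const R); exact: Pc.
apply: PD Pp; rewrite -mul_mpolyC; apply: (PM); first exact: Pc.
rewrite mpolyXE_id; apply: (big_ind P) => [|//|i _].
- by have <- := rmorph1 (@const R); exact: Pc.
elim: (m i) => [|n IHn]; last by rewrite exprS; exact: PM (Pv i) IHn.
by rewrite expr0; have <- := rmorph1 (@const R); exact: Pc.
Qed.

Section Psubst.
Variable Phi : ratmap R.

Lemma psubst_is_zmod_morphism : zmod_morphism (psubst Phi).
Proof. exact: (mmap_is_additive (Phi 0) ratconst). Qed.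
HB.instance Definition _ := GRing.isZmodMorphism.Build _ _ (psubst Phi)
  psubst_is_zmod_morphism.

Lemma psubst_is_monoid_morphism : monoid_morphism (psubst Phi).
Proof.
by have [hM h1] := mmap_is_multiplicative (Phi 0) ratconst; split.
Qed.
HB.instance Definition _ := GRing.isMonoidMorphism.Build _ _ (psubst Phi)
  psubst_is_monoid_morphism.

Lemma psubst_const c : psubst Phi (const c) = ratconst c.
Proof. exact: (mmapC (Phi 0) ratconst c). Qed.

Lemma psubst_var i : psubst Phi (var R i) = Phi 0 i.
Proof. by have := mmapX (Phi 0) ratconst (mnm1 i); rewrite mmap1U. Qed.

End Psubst.

Section Peval.
Variable v : plane R.

(** The point comes first here, so that evaluation can carry a ring morphism structure. *)
Definition pev (p : bipoly R) : C := peval p v.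

Lemma pev_is_zmod_morphism : zmod_morphism pev.
Proof. exact: (mmap_is_additive (v 0) idfun). Qed.
HB.instance Definition _ := GRing.isZmodMorphism.Build _ _ pev
  pev_is_zmod_morphism.

Lemma pev_is_monoid_morphism : monoid_morphism pev.
Proof.
by have [hM h1] := mmap_is_multiplicative (v 0) (idfun : C -> C); split.
Qed.
HB.instance Definition _ := GRing.isMonoidMorphism.Build _ _ pev
  pev_is_monoid_morphism.

Lemma peval_const c : peval (const c) v = c.
Proof. exact: mevalC. Qed.

Lemma peval_var i : peval (var R i) v = v 0 i.
Proof. exact: mevalXU. Qed.

Lemma pevalD p q : peval (p + q) v = peval p v + peval q v.
Proof. exact: (rmorphD pev). Qed.

Lemma pevalB p q : peval (p - q) v = peval p v - peval q v.
Proof. exact: (rmorphB pev). Qed.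

Lemma pevalM p q : peval (p * q) v = peval p v * peval q v.
Proof. exact: (rmorphM pev). Qed.

Lemma pevalX p n : peval (p ^+ n) v = peval p v ^+ n.
Proof. exact: (rmorphXn pev). Qed.

Lemma pevalN p : peval (- p) v = - peval p v.
Proof. exact: (rmorphN pev). Qed.

Lemma peval0 : peval 0 v = 0.
Proof. exact: (rmorph0 pev). Qed.

Lemma peval1 : peval 1 v = 1.
Proof. exact: (rmorph1 pev). Qed.

End Peval.

Lemma mderiv_const i c : mderiv i (const c) = 0 :> bipoly R.
Proof. exact: mderivC. Qed.

Lemma mderiv_var i j : mderiv i (var R j) = (i == j)%:R.
Proof.
rewrite mderivX mnm1E eq_sym; case: eqP => [->|_]; last by rewrite scale0r.
by rewrite scale1r -[X in mnm_sub X]add0m addmK mpolyX0.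
Qed.

(** The numerator and denominator belong to a chosen representative; this identity and
    [denom f != 0] are all that is used about them. *)
Lemma fracE (f : birat R) : f = tofrac (numer f) / tofrac (denom f).
Proof.
have d0 : tofrac (denom f) != 0 by rewrite tofrac_eq0 denom_ratioP.
apply: (canRL (mulfK d0)); rewrite -[X in X * _]reprK /numer /denom.
unlock FracField.tofrac; rewrite -[LHS]FracField.pi_mul.
apply/eqmodP; rewrite /= FracField.equivfE /FracField.mulf /=.
by rewrite !numden_Ratio ?mulf_neq0 ?oner_eq0 ?denom_ratioP // mulr1 mulr1
  mulrC.
Qed.

Lemma denom_neq0 (f : birat R) : denom f != 0.
Proof. exact: denom_ratioP. Qed.

Lemma birat_ind (P : birat R -> Prop) :
  (forall n d : bipoly R, d != 0 -> P (tofrac n / tofrac d)) ->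
  forall f, P f.
Proof. by move=> h f; rewrite [f]fracE; apply: h; apply: denom_neq0. Qed.

Lemma frac_eq (n d n' d' : bipoly R) : d != 0 -> d' != 0 ->
  tofrac n / tofrac d = tofrac n' / tofrac d' -> n * d' = n' * d.
Proof.
move=> d0 d0' /eqP; rewrite eqr_div ?tofrac_eq0 // -!tofracM tofrac_eq.
by move=> /eqP.
Qed.

End Substitution.

Section RationalDerivation.
Variable R : realType.

(** The second equation is the derivative of the first, [N d = n D]. Eliminating [N] and [N'] shows
    that the quotient rule does not depend on the fraction. *)
Lemma quotient_rule_indep (F : fieldType) (n d N D n' d' N' D' : F) :
  d != 0 -> D != 0 -> N * d = n * D ->
  N' * d + N * d' = n' * D + n * D' ->
  (N' * D - N * D') / D ^+ 2 = (n' * d - n * d') / d ^+ 2.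
Proof.
move=> d0 D0 e e'.
have eN : N = n * D / d by rewrite -e mulfK.
have eN' : N' = (n' * D + n * D' - N * d') / d by rewrite -e' addrK mulfK.
by rewrite eN' eN; field; rewrite d0 D0.
Qed.

Section AbstractQuotientRules.
Variables (A : comNzRingType) (F : fieldType) (f : {rmorphism A -> F}).

(** Primed letters stand for derivatives but are arbitrary, which turns the sum rule into an
    identity of [F]. *)
Lemma quotient_ruleD (n d m e n' d' m' e' : A) : f d != 0 -> f e != 0 ->
  f ((n' * e + n * e' + (m' * d + m * d')) * (d * e)
     - (n * e + m * d) * (d' * e + d * e')) / f ((d * e) ^+ 2) =
  f (n' * d - n * d') / f (d ^+ 2) + f (m' * e - m * e') / f (e ^+ 2).
Proof.
move=> d0 e0; rewrite !(rmorphB, rmorphD, rmorphM, rmorphXn) /=.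
by field; rewrite d0 e0.
Qed.

Lemma quotient_ruleM (n d m e n' d' m' e' : A) : f d != 0 -> f e != 0 ->
  f ((n' * m + n * m') * (d * e) - n * m * (d' * e + d * e'))
    / f ((d * e) ^+ 2) =
  f (n' * d - n * d') / f (d ^+ 2) * (f m / f e)
  + f n / f d * (f (m' * e - m * e') / f (e ^+ 2)).
Proof.
move=> d0 e0; rewrite !(rmorphB, rmorphD, rmorphM, rmorphXn) /=.
by field; rewrite d0 e0.
Qed.

End AbstractQuotientRules.

Lemma rderiv_frac i (n d : bipoly R) : d != 0 ->
  rderiv i (tofrac n / tofrac d) =
  tofrac (mderiv i n * d - n * mderiv i d) / tofrac (d ^+ 2).
Proof.
move=> d0; rewrite /rderiv; set f := tofrac n / tofrac d.
have e : numer f * d = n * denom f.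
  by apply: (frac_eq (denom_neq0 f) d0); rewrite -fracE.
have := congr1 (mderiv i) e; rewrite !mderivM.
have := denom_neq0 f; move: e; move: (mderiv i (numer f)) (mderiv i (denom f)).
move: (numer f) (denom f) (mderiv i n) (mderiv i d) => N D n' d' N' D' e D0 e'.
have [e1 e1'] := (congr1 (@tofrac _) e, congr1 (@tofrac _) e').
rewrite !(tofracM, tofracD) in e1 e1'; rewrite !(tofracB, tofracM, tofracXn).
by apply: quotient_rule_indep; rewrite ?tofrac_eq0.
Qed.

Lemma rderiv_tofrac i (p : bipoly R) :
  rderiv i (tofrac p) = tofrac (mderiv i p).
Proof.
rewrite -[tofrac p]divr1 -(tofrac1 (bipoly R)) rderiv_frac ?oner_neq0 //.
have -> : mderiv i 1 = 0 :> bipoly R.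
  by rewrite -(rmorph1 (@const R)) mderiv_const.
by rewrite mulr1 mulr0 subr0 expr1n tofrac1 divr1.
Qed.

Lemma rderivD i (f g : birat R) : rderiv i (f + g) = rderiv i f + rderiv i g.
Proof.
elim/birat_ind: f => n d d0; elim/birat_ind: g => m e e0.
have [d1 e1] : tofrac d != 0 /\ tofrac e != 0 by rewrite !tofrac_eq0.
have -> : tofrac n / tofrac d + tofrac m / tofrac e
    = tofrac (n * e + m * d) / tofrac (d * e).
  by rewrite (addf_div _ _ d1 e1) tofracD !tofracM.
rewrite (rderiv_frac i _ (mulf_neq0 d0 e0)) (rderiv_frac i _ d0) (rderiv_frac i
  _ e0).
rewrite mderivD !mderivM.
exact: (quotient_ruleD _ _ _ _ _ _ d1 e1).
Qed.

Lemma rderivM i (f g : birat R) :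
  rderiv i (f * g) = rderiv i f * g + f * rderiv i g.
Proof.
elim/birat_ind: f => n d d0; elim/birat_ind: g => m e e0.
have [d1 e1] : tofrac d != 0 /\ tofrac e != 0 by rewrite !tofrac_eq0.
have -> : tofrac n / tofrac d * (tofrac m / tofrac e)
    = tofrac (n * m) / tofrac (d * e).
  by rewrite mulf_div !tofracM.
rewrite (rderiv_frac i _ (mulf_neq0 d0 e0)) (rderiv_frac i _ d0) (rderiv_frac i
  _ e0).
rewrite !mderivM.
exact: (quotient_ruleM _ _ _ _ _ _ d1 e1).
Qed.

Lemma rderiv_psubst (Psi : ratmap R) j (p : bipoly R) :
  rderiv j (psubst Psi p) =
  \sum_i psubst Psi (mderiv i p) * rderiv j (Psi 0 i).
Proof.
elim/bipoly_ind: p => [c|k|p q IHp IHq|p q IHp IHq].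
- rewrite psubst_const rderiv_tofrac mderiv_const rmorph0 big1 // => i _.
  by rewrite mderiv_const rmorph0 mul0r.
- rewrite psubst_var (bigD1 k) //= mderiv_var eqxx rmorph1 mul1r big1 ?addr0 //.
  by move=> i ik; rewrite mderiv_var (negbTE ik) rmorph0 mul0r.
- rewrite rmorphD rderivD IHp IHq -big_split; apply: eq_bigr => i _ /=.
  by rewrite mderivD rmorphD mulrDl.
rewrite rmorphM rderivM IHp IHq mulr_suml mulr_sumr -big_split.
apply: eq_bigr => i _ /=; rewrite mderivM rmorphD !rmorphM mulrDl.
by congr (_ + _); [rewrite mulrAC|rewrite mulrA].
Qed.

End RationalDerivation.

(** * Substitution of a dominant map into rational functions *)

Section Dominant.
Variables (R : realType) (Phi : ratmap R).
(** Dominance of [Phi]: no nonzero denominator is sent to 0, so the value of [rsubst] is the same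
    for all fractions representing a function. *)
Hypothesis dom : forall p, psubst Phi p = 0 -> p = 0.

Let psubst_neq0 p : p != 0 -> psubst Phi p != 0.
Proof. by apply: contraNneq => /dom ->. Qed.

Lemma rsubst_frac (n d : bipoly R) : d != 0 ->
  rsubst Phi (tofrac n / tofrac d) = psubst Phi n / psubst Phi d.
Proof.
move=> d0; rewrite /rsubst; set f := tofrac n / tofrac d.
have e : numer f * d = n * denom f.
  by apply: (frac_eq (denom_neq0 f) d0); rewrite -fracE.
apply/eqP; rewrite eqr_div ?psubst_neq0 ?denom_neq0 //.
by rewrite -!rmorphM e.
Qed.

Lemma rsubst_tofrac (p : bipoly R) : rsubst Phi (tofrac p) = psubst Phi p.
Proof.
rewrite -[tofrac p]divr1 -(tofrac1 (bipoly R)) rsubst_frac ?oner_neq0 //.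
by rewrite rmorph1 divr1.
Qed.

Lemma rsubst_is_nmod_morphism : zmod_morphism (rsubst Phi).
Proof.
elim/birat_ind=> n d d0; elim/birat_ind=> m e e0.
have [d1 e1] : tofrac d != 0 /\ tofrac e != 0 by rewrite !tofrac_eq0.
have [d2 e2] := (psubst_neq0 d0, psubst_neq0 e0).
have -> : tofrac n / tofrac d - tofrac m / tofrac e
    = tofrac (n * e - m * d) / tofrac (d * e).
  by rewrite -mulNr (addf_div _ _ d1 e1) tofracB !tofracM mulNr.
rewrite (rsubst_frac _ (mulf_neq0 d0 e0)) (rsubst_frac _ d0) (rsubst_frac _ e0).
by rewrite -[in RHS]mulNr (addf_div _ _ d2 e2) rmorphB !rmorphM mulNr.
Qed.

Lemma rsubst_is_monoid_morphism : monoid_morphism (rsubst Phi).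
Proof.
split; first by rewrite -(tofrac1 (bipoly R)) rsubst_tofrac rmorph1.
elim/birat_ind=> n d d0; elim/birat_ind=> m e e0.
have -> : tofrac n / tofrac d * (tofrac m / tofrac e)
    = tofrac (n * m) / tofrac (d * e) by rewrite mulf_div !tofracM.
rewrite (rsubst_frac _ (mulf_neq0 d0 e0)) (rsubst_frac _ d0) (rsubst_frac _ e0).
by rewrite mulf_div !rmorphM.
Qed.

(** The morphism structure depends on the proof of dominance, hence the existential form instead of
    a structure attached to [rsubst Phi]. *)
Lemma rsubst_rmorphism : exists f : {rmorphism birat R -> birat R},
  forall x, f x = rsubst Phi x.
Proof.
pose a := GRing.isZmodMorphism.Build _ _ _ rsubst_is_nmod_morphism.
pose b := GRing.isMonoidMorphism.Build _ _ _ rsubst_is_monoid_morphism.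
pose f : {rmorphism birat R -> birat R} := HB.pack (rsubst Phi) a b.
by exists f.
Qed.

End Dominant.

(** * Values of rational functions at regular points *)

Section RegularValues.
Variables (R : realType) (v : plane R).
Local Notation C := (Cplx R).

Lemma peval_neq0 (d : bipoly R) : peval d v != 0 -> d != 0.
Proof. by apply: contraNneq => ->; rewrite peval0. Qed.

Lemma rvalue_at_uniq (f : birat R) (z z' : C) :
  rvalue_at f v z -> rvalue_at f v z' -> z = z'.
Proof.
move=> [n [d [d0 fE ->]]] [n' [d' [d0' fE' ->]]].
apply/eqP; rewrite eqr_div // -!pevalM; apply/eqP; congr peval.
by apply: frac_eq; rewrite -?fE -?fE' // (peval_neq0 d0, peval_neq0 d0').
Qed.

Lemma rvalueE (f : birat R) (z : C) : rvalue_at f v z -> rvalue f v = z.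
Proof.
move=> fz; apply: (rvalue_at_uniq _ fz).
by apply: (@xgetPex C 0 (rvalue_at f v)); exists z.
Qed.

Lemma regular_at_rvalue (f : birat R) :
  regular_at f v -> rvalue_at f v (rvalue f v).
Proof. by move=> [z fz]; rewrite (rvalueE fz). Qed.

Lemma rvalue_at_tofrac (p : bipoly R) : rvalue_at (tofrac p) v (peval p v).
Proof.
by exists p, 1; rewrite tofrac1 peval1 oner_neq0 !divr1; split.
Qed.

Lemma rvalue_at_const (c : C) : rvalue_at (ratconst c) v c.
Proof. by rewrite -[X in rvalue_at _ _ X](peval_const v);
  exact: rvalue_at_tofrac. Qed.

Section Closure.
Variables (f g : birat R) (x y : C).
Hypotheses (fx : rvalue_at f v x) (gy : rvalue_at g v y).

Lemma rvalue_atD : rvalue_at (f + g) v (x + y).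
Proof.
have [[n [d [d0 -> ->]]] [m [e [e0 -> ->]]]] := (fx, gy).
have [d1 e1] : tofrac d != 0 /\ tofrac e != 0.
  by rewrite !tofrac_eq0 !peval_neq0.
exists (n * e + m * d), (d * e); split; first by rewrite pevalM mulf_neq0.
  by rewrite (addf_div _ _ d1 e1) tofracD !tofracM.
by rewrite addf_div // pevalD !pevalM.
Qed.

Lemma rvalue_atM : rvalue_at (f * g) v (x * y).
Proof.
have [[n [d [d0 -> ->]]] [m [e [e0 -> ->]]]] := (fx, gy).
exists (n * m), (d * e); split; first by rewrite pevalM mulf_neq0.
  by rewrite mulf_div !tofracM.
by rewrite mulf_div !pevalM.
Qed.

Lemma rvalue_atN : rvalue_at (- f) v (- x).
Proof.
have [n [d [d0 -> ->]]] := fx; exists (- n), d; split=> //.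
  by rewrite tofracN mulNr.
by rewrite pevalN mulNr.
Qed.

Lemma rvalue_atV : x != 0 -> rvalue_at f^-1 v x^-1.
Proof.
have [n [d [d0 -> ->]]] := fx; rewrite mulf_eq0 invr_eq0 negb_or => /andP[n0 _].
by exists d, n; split; rewrite ?invf_div.
Qed.

Lemma rvalue_at_neq0 : x != 0 -> f != 0.
Proof.
have [n [d [d0 -> ->]]] := fx; rewrite mulf_eq0 invr_eq0 negb_or => /andP[n0 _].
by rewrite mulf_neq0 ?invr_eq0 ?tofrac_eq0 ?peval_neq0.
Qed.

End Closure.

Lemma rvalue_at_rderiv (i : 'I_2) (n d : bipoly R) : peval d v != 0 ->
  rvalue_at (rderiv i (tofrac n / tofrac d)) v
    ((peval (mderiv i n) v * peval d v - peval n v * peval (mderiv i d) v)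
     / peval d v ^+ 2).
Proof.
move=> d0; rewrite (rderiv_frac i _ (peval_neq0 d0)).
exists (mderiv i n * d - n * mderiv i d), (d ^+ 2).
by rewrite pevalX pevalB !pevalM expf_neq0.
Qed.

Lemma regular_at_rderiv (i : 'I_2) (f : birat R) :
  regular_at f v -> regular_at (rderiv i f) v.
Proof.
by move=> [z [n [d [d0 -> _]]]]; eexists; apply: rvalue_at_rderiv.
Qed.

End RegularValues.

(** * Relations between two fields compatible with the operations *)

Section FieldRelation.
Variables (R : realType) (F F' : fieldType).
Local Notation C := (Cplx R).
Variables (io : {rmorphism C -> F}) (io' : {rmorphism C -> F'}).
Variable Rel : F -> F' -> Prop.

(* Both evaluation at a regular point and the graph of a field morphism are
   such relations. *)
Record field_relation : Prop := FieldRelation {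
  relC : forall c, Rel (io c) (io' c);
  relD : forall x x' y y', Rel x x' -> Rel y y' -> Rel (x + y) (x' + y');
  relM : forall x x' y y', Rel x x' -> Rel y y' -> Rel (x * y) (x' * y');
  relN : forall x x', Rel x x' -> Rel (- x) (- x');
  relV : forall x x', Rel x x' -> x' != 0 -> Rel x^-1 x'^-1 }.

Hypothesis FR : field_relation.

Lemma rel0 : Rel 0 0.
Proof. by have := relC FR 0; rewrite !rmorph0. Qed.

Lemma rel1 : Rel 1 1.
Proof. by have := relC FR 1; rewrite !rmorph1. Qed.

Lemma relB x x' y y' : Rel x x' -> Rel y y' -> Rel (x - y) (x' - y').
Proof. by move=> xx yy; apply: relD => //; apply: relN. Qed.

Lemma relX x x' n : Rel x x' -> Rel (x ^+ n) (x' ^+ n).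
Proof.
move=> xx; elim: n => [|n IHn]; first exact: rel1.
by rewrite !exprS; apply: relM.
Qed.

Lemma rel_div x x' y y' :
  Rel x x' -> Rel y y' -> y' != 0 -> Rel (x / y) (x' / y').
Proof. by move=> xx yy y0; apply: relM => //; apply: relV. Qed.

Lemma rel_prod n (f : 'I_n -> F) (g : 'I_n -> F') :
  (forall i, Rel (f i) (g i)) -> Rel (\prod_i f i) (\prod_i g i).
Proof. move=> fg; apply: (big_ind2 Rel) => [|x x' y y'|i _]; first exact: rel1.
  exact: (relM FR).
exact: fg. Qed.

Lemma rel_horner (P : {poly C}) x x' :
  Rel x x' -> Rel (map_poly io P).[x] (map_poly io' P).[x'].
Proof.
move=> xx; elim/poly_ind: P => [|P c IHP]; first by rewrite !rmorph0 !horner0;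
  exact: rel0.
rewrite !rmorphD !rmorphM /= !map_polyX !map_polyC !hornerE.
by apply: relD => //; [apply: relM|apply: relC].
Qed.

End FieldRelation.
(** * Explicit inverse of the rectifying map *)

Section MonomialInverse.
Variable F : fieldType.

(* Inverse of the unimodular monomial map (x, s) |-> (x^q1 s^q, x^p1 s^p);
   b tells whether p q1 - q p1 is 1 or -1. *)
Definition monx (b : bool) (p q : nat) (t u : F) : F :=
  if b then t ^+ p / u ^+ q else u ^+ q / t ^+ p.
Definition mons (b : bool) (p1 q1 : nat) (t u : F) : F :=
  if b then u ^+ q1 / t ^+ p1 else t ^+ p1 / u ^+ q1.

(** The determinant condition is written with sums because subtraction of natural numbers
    truncates. *)
Definition unimodular (b : bool) (p q p1 q1 : nat) : Prop :=
  if b then (p * q1 = q * p1 + 1)%N else (q * p1 = p * q1 + 1)%N.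

Section Inverse.
Variables (b : bool) (p q p1 q1 : nat).
Hypothesis det1 : unimodular b p q p1 q1.

(** In [t ^+ p / u ^+ q] the exponent of [x] is [p q1 - q p1] and that of [s] is [q p - p q = 0];
    the other cases are similar, and the determinant turns the first exponent into 1. *)
Lemma mon_xs (x s : F) : x != 0 -> s != 0 ->
  monx b p q (x ^+ q1 * s ^+ q) (x ^+ p1 * s ^+ p) = x /\
  mons b p1 q1 (x ^+ q1 * s ^+ q) (x ^+ p1 * s ^+ p) = s.
Proof.
move=> x0 s0; rewrite /monx /mons !exprMn -!exprM.
rewrite ![(q1 * _)%N]mulnC ![(p1 * _)%N]mulnC.
have [xn0 sn0] : (forall n, x ^+ n != 0) /\ (forall n, s ^+ n != 0).
  by split=> n; apply: expf_neq0.
have pq : (p * q = q * p)%N by rewrite mulnC.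
have p1q : (q1 * p1 = p1 * q1)%N by rewrite mulnC.
by case: b det1 => /= ->; rewrite pq p1q exprD expr1 addn1 ?exprS;
  split; field; rewrite !xn0 !sn0.
Qed.

Lemma mon_tu (t u : F) : t != 0 -> u != 0 ->
  monx b p q t u ^+ q1 * mons b p1 q1 t u ^+ q = t /\
  monx b p q t u ^+ p1 * mons b p1 q1 t u ^+ p = u.
Proof.
move=> t0 u0.
have [tn0 un0] : (forall n, t ^+ n != 0) /\ (forall n, u ^+ n != 0).
  by split=> n; apply: expf_neq0.
rewrite /monx /mons; have [pq1 qp1] : (p * q1 = q1 * p /\ q * p1 = p1 * q)%N.
  by split; rewrite mulnC.
have [qq1 pp1] : (q * q1 = q1 * q /\ p * p1 = p1 * p)%N by split; rewrite mulnC.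
by case: b det1 => /= e; rewrite !expr_div_n -!exprM ?e -?pq1 -?qp1 -?qq1
  -?pp1 ?e; split; rewrite ?exprD ?expr1; field; rewrite !tn0 !un0.
Qed.

End Inverse.

Lemma monx_neq0 b p q t u : t != 0 -> u != 0 -> monx b p q t u != 0.
Proof.
by move=> t0 u0; rewrite /monx; case: b; rewrite mulf_neq0 ?invr_eq0 ?expf_neq0.
Qed.

Lemma mons_neq0 b p1 q1 t u : t != 0 -> u != 0 -> mons b p1 q1 t u != 0.
Proof.
by move=> t0 u0; rewrite /mons; case: b; rewrite mulf_neq0 ?invr_eq0 ?expf_neq0.
Qed.

End MonomialInverse.

(** The sign of the determinant is read off the exponents by a boolean test, so the inverse is a
    closed formula in the data of the normal form. *)
Lemma exponents_unimodular (p q p1 q1 : nat) : exponents_ok p q p1 q1 ->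
  unimodular (p * q1 == q * p1 + 1)%N p q p1 q1.
Proof.
case=> _ _ h; rewrite /unimodular; case: eqP => // ne.
by case: h => h; lia.
Qed.

(** * Normal forms and their inverses over an arbitrary field *)

Section NormalFormValues.
Variables (R : realType) (F : fieldType).
Local Notation C := (Cplx R).
Variable io : {rmorphism C -> F}.
Implicit Types (nf : normal_form R) (x y t c : F).

Definition skel k (P : {poly C}) x y : F := x ^+ k * y + (map_poly io P).[x].

Definition betaprod n (beta : 'I_n -> C) (a : 'I_n -> nat) t : F :=
  \prod_(i < n) (io (beta i) - t) ^+ a i.

Definition gval nf x y : F :=
  match nf with
  | NF1 _ p q p1 q1 k P _ _ | NF2 _ p q p1 q1 k P _ _ =>
      x ^+ q1 * skel k P x y ^+ q
  | NF3 _ _ _ _ => x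
  end.

Definition hval nf x y : F :=
  match nf with
  | NF1 _ p q p1 q1 k P beta a =>
      x ^+ q1 * skel k P x y ^+ q
      + x ^+ p1 * skel k P x y ^+ p * betaprod beta a (gval nf x y)
  | NF2 _ p q p1 q1 k P beta a =>
      x ^+ p1 * skel k P x y ^+ p * betaprod beta a (gval nf x y)
  | NF3 _ beta a h => y * betaprod beta a x + (map_poly io h).[x]
  end.

(* Off the zero sets of these expressions, (gval, hval) is biregular. *)
Definition good nf x y : bool :=
  match nf with
  | NF1 _ p q p1 q1 k P beta a | NF2 _ p q p1 q1 k P beta a =>
      [&& x != 0, skel k P x y != 0 & betaprod beta a (gval nf x y) != 0]
  | NF3 _ beta a h => betaprod beta a x != 0
  end.

(** The counterpart of [good] in target coordinates: the product of [x^p1 S^p] and the beta factors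
    is [c - t] in the first family and [c] in the second. *)
Definition tgood nf t c : bool :=
  match nf with
  | NF1 _ _ _ _ _ _ _ beta a => [&& t != 0, c - t != 0 & betaprod beta a t != 0]
  | NF2 _ _ _ _ _ _ _ beta a => [&& t != 0, c != 0 & betaprod beta a t != 0]
  | NF3 _ beta a h => betaprod beta a t != 0
  end.

(** The monomial [x^p1 S^p], recovered from [t = G] and [c = H]; for the third family, [y]
    itself. *)
Definition uval nf t c : F :=
  match nf with
  | NF1 _ _ _ _ _ _ _ beta a => (c - t) / betaprod beta a t
  | NF2 _ _ _ _ _ _ _ beta a => c / betaprod beta a t
  | NF3 _ beta a h => (c - (map_poly io h).[t]) / betaprod beta a t
  end.

Definition invx nf t c : F :=
  match nf with
  | NF1 _ p q p1 q1 _ _ _ _ | NF2 _ p q p1 q1 _ _ _ _ =>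
      monx (p * q1 == q * p1 + 1)%N p q t (uval nf t c)
  | NF3 _ _ _ _ => t
  end.

Definition invy nf t c : F :=
  match nf with
  | NF1 _ p q p1 q1 k P _ _ | NF2 _ p q p1 q1 k P _ _ =>
      (mons (p * q1 == q * p1 + 1)%N p1 q1 t (uval nf t c)
       - (map_poly io P).[invx nf t c]) / invx nf t c ^+ k
  | NF3 _ _ _ _ => uval nf t c
  end.

Lemma skelK k P x s : x != 0 ->
  skel k P x ((s - (map_poly io P).[x]) / x ^+ k) = s.
Proof. by move=> x0; rewrite /skel mulrC divfK ?expf_neq0 // subrK. Qed.

Lemma good_tgood nf x y :
  good nf x y -> tgood nf (gval nf x y) (hval nf x y).
Proof.
by case: nf => [r p q p1 q1 k P beta a|r p q p1 q1 k P beta a|//] /=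
  /and3P[x0 s0 b0]; rewrite ?[_ + _ - _]addrC ?addKr !mulf_neq0 ?expf_neq0.
Qed.

Lemma invxyK nf x y : nf_ok nf -> good nf x y ->
  invx nf (gval nf x y) (hval nf x y) = x /\
  invy nf (gval nf x y) (hval nf x y) = y.
Proof.
case: nf => [r p q p1 q1 k P beta a|r p q p1 q1 k P beta a|r beta a h] /=.
- move=> [_ _ /exponents_unimodular det1 _ _] /and3P[x0 s0 b0].
  rewrite [_ + _ - _]addrC addKr mulfK //.
  have [-> ->] := mon_xs det1 x0 s0; split=> //.
  by rewrite /skel addrK mulrC mulKf ?expf_neq0.
- move=> [_ _ /exponents_unimodular det1 _ _] /and3P[x0 s0 b0].
  rewrite mulfK //; have [-> ->] := mon_xs det1 x0 s0; split=> //.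
  by rewrite /skel addrK mulrC mulKf ?expf_neq0.
by move=> _ b0; rewrite addrK mulfK.
Qed.

Lemma ghvalK nf t c : nf_ok nf -> tgood nf t c ->
  gval nf (invx nf t c) (invy nf t c) = t /\
  hval nf (invx nf t c) (invy nf t c) = c.
Proof.
case: nf => [r p q p1 q1 k P beta a|r p q p1 q1 k P beta a|r beta a h] /=.
- move=> [_ _ /exponents_unimodular det1 _ _] /and3P[t0 c0 b0].
  have u0 : (c - t) / betaprod beta a t != 0 by rewrite mulf_neq0 ?invr_eq0.
  rewrite skelK ?monx_neq0 //; have [-> ->] := mon_tu det1 t0 u0.
  by rewrite divfK // addrC subrK.
- move=> [_ _ /exponents_unimodular det1 _ _] /and3P[t0 c0 b0].
  have u0 : c / betaprod beta a t != 0 by rewrite mulf_neq0 ?invr_eq0.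
  rewrite skelK ?monx_neq0 //; have [-> ->] := mon_tu det1 t0 u0.
  by rewrite divfK.
by move=> _ b0; rewrite divfK // subrK.
Qed.

Lemma tgood_good nf t c : nf_ok nf -> tgood nf t c ->
  good nf (invx nf t c) (invy nf t c).
Proof.
move=> ok tg; have [gE _] := ghvalK ok tg; move: ok tg gE.
case: nf => [r p q p1 q1 k P beta a|r p q p1 q1 k P beta a|r beta a h] //=.
- move=> _ /and3P[t0 c0 b0] ->.
  have u0 : (c - t) / betaprod beta a t != 0 by rewrite mulf_neq0 ?invr_eq0.
  by rewrite skelK ?monx_neq0 // mons_neq0.
- move=> _ /and3P[t0 c0 b0] ->.
  have u0 : c / betaprod beta a t != 0 by rewrite mulf_neq0 ?invr_eq0.
  by rewrite skelK ?monx_neq0 // mons_neq0.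
Qed.

Section Morphism.
Variable f : {rmorphism bipoly R -> F}.
Hypothesis f_const : forall c : C, f (const c) = io c.
Let X := f (var R 0).
Let Y := f (var R 1).

Lemma morph_poly_in_x P : f (poly_in_x P) = (map_poly io P).[X].
Proof.
rewrite /poly_in_x -horner_map -map_poly_comp; congr _.[_].
by apply: eq_map_poly => c /=.
Qed.

Lemma morph_skeleton k P : f (skeleton k P) = skel k P X Y.
Proof. by rewrite rmorphD rmorphM rmorphXn morph_poly_in_x. Qed.

Lemma morph_xS k P m n : f (xS k P m n) = X ^+ m * skel k P X Y ^+ n.
Proof. by rewrite rmorphM !rmorphXn /= morph_skeleton. Qed.

Lemma morph_beta_prod n (beta : 'I_n -> C) (a : 'I_n -> nat) g :
  f (beta_prod beta a g) = betaprod beta a (f g).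
Proof.
rewrite rmorph_prod; apply: eq_bigr => i _.
by rewrite rmorphXn rmorphB /= f_const.
Qed.

(** This serves for three morphisms: evaluation at a point, the embedding [tofrac], and substitution
    of a rational map. *)
Lemma morph_nf_G nf : f (nf_G nf) = gval nf X Y.
Proof. by case: nf => *; rewrite /= ?morph_xS. Qed.

Lemma morph_nf_H nf : f (nf_H nf) = hval nf X Y.
Proof.
case: nf => [r p q p1 q1 k P beta a|r p q p1 q1 k P beta a|r beta a h] /=.
- rewrite rmorphD (rmorphM f (xS k P p1 p)) /=.
  by rewrite morph_beta_prod !morph_xS.
- by rewrite (rmorphM f (xS k P p1 p)) /= morph_beta_prod !morph_xS.
by rewrite rmorphD (rmorphM f (var R 1)) /= morph_beta_prod morph_poly_in_x.
Qed.

End Morphism.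

End NormalFormValues.

Section InverseRelation.
Variables (R : realType) (F F' : fieldType).
Local Notation C := (Cplx R).
Variables (io : {rmorphism C -> F}) (io' : {rmorphism C -> F'}).
Variable Rel : F -> F' -> Prop.
Hypothesis FR : field_relation io io' Rel.
Variables (nf : normal_form R) (t c : F) (t' c' : F').
Hypotheses (tt' : Rel t t') (cc' : Rel c c') (tg : tgood io' nf t' c').

Lemma rel_betaprod n (beta : 'I_n -> C) (a : 'I_n -> nat) :
  Rel (betaprod io beta a t) (betaprod io' beta a t').
Proof.
apply: (rel_prod FR) => i; apply: (relX FR).
by apply: (relB FR) => //; apply: relC.
Qed.

Lemma rel_uval : Rel (uval io nf t c) (uval io' nf t' c').
Proof.
case: nf tg => [r p q p1 q1 k P beta a|r p q p1 q1 k P beta a|r beta a h] /=;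
  [move=> /and3P[_ _ b0]|move=> /and3P[_ _ b0]|move=> b0];
  apply: (rel_div FR) => //; try exact: rel_betaprod.
  exact: (relB FR).
by apply: (relB FR) => //; apply: (rel_horner FR).
Qed.

Lemma uval_neq0 : if nf is NF3 _ _ _ _ then True else
  t' != 0 /\ uval io' nf t' c' != 0.
Proof.
by case: nf tg => [r p q p1 q1 k P beta a|r p q p1 q1 k P beta a|//] /=
  /and3P[t0 c0 b0]; rewrite mulf_neq0 ?invr_eq0.
Qed.

Lemma rel_monx b p q u u' : Rel u u' -> t' != 0 -> u' != 0 ->
  Rel (monx b p q t u) (monx b p q t' u').
Proof.
by move=> uu t0 u0; rewrite /monx; case: b;
  apply: (rel_div FR); rewrite ?expf_neq0 //; apply: (relX FR).
Qed.

Lemma rel_mons b p q u u' : Rel u u' -> t' != 0 -> u' != 0 ->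
  Rel (mons b p q t u) (mons b p q t' u').
Proof.
by move=> uu t0 u0; rewrite /mons; case: b;
  apply: (rel_div FR); rewrite ?expf_neq0 //; apply: (relX FR).
Qed.

Lemma rel_invx : Rel (invx io nf t c) (invx io' nf t' c').
Proof.
move: rel_uval uval_neq0; rewrite /invx.
by case: nf => [r p q p1 q1 k P beta a|r p q p1 q1 k P beta a|//] uu [t0 u0];
  apply: rel_monx.
Qed.

Lemma rel_invy : Rel (invy io nf t c) (invy io' nf t' c').
Proof.
move: rel_invx rel_uval uval_neq0; rewrite /invy.
case: nf => [r p q p1 q1 k P beta a|r p q p1 q1 k P beta a|//] xx uu [t0 u0];
  (apply: (rel_div FR);
    [|exact: (relX FR)|by rewrite expf_neq0 // monx_neq0]);
  (apply: (relB FR); [exact: rel_mons|exact: (rel_horner FR)]).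
Qed.

(** A rational function with a nonzero value at some point is nonzero. With evaluation as [Rel], a
    single point satisfying the conditions makes them hold over the function field. *)
Lemma rel_tgood : (forall x x', Rel x x' -> x' != 0 -> x != 0) ->
  tgood io nf t c.
Proof.
move=> r0; move: tg; rewrite /tgood.
case: nf => [r p q p1 q1 k P beta a|r p q p1 q1 k P beta a|r beta a h].
- move=> /and3P[t0 c0 b0]; apply/and3P; split.
  + exact: r0 t0.
  + by apply: r0 c0; apply: (relB FR).
  + by apply: r0 b0; apply: rel_betaprod.
- move=> /and3P[t0 c0 b0]; apply/and3P; split.
  + exact: r0 t0.
  + exact: r0 c0.
  + by apply: r0 b0; apply: rel_betaprod.
by move=> b0; apply: r0 b0; apply: rel_betaprod.
Qed.

(** Here [t] and [c] play the part of the source coordinates [x] and [y]. *)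
Lemma rel_good : (forall x x', Rel x x' -> x' != 0 -> x != 0) ->
  good io' nf t' c' -> good io nf t c.
Proof.
move=> r0; rewrite /good.
have rel_skel k P : Rel (skel io k P t c) (skel io' k P t' c').
  apply: (relD FR); last exact: (rel_horner FR).
  by apply: (relM FR) => //; apply: (relX FR).
have rel_bp n (beta : 'I_n -> C) a x x' : Rel x x' ->
    betaprod io' beta a x' != 0 -> betaprod io beta a x != 0.
  move=> xx; apply: r0; apply: (rel_prod FR) => i; apply: (relX FR).
  by apply: (relB FR) => //; apply: relC.
case: nf => [r p q p1 q1 k P beta a|r p q p1 q1 k P beta a|r beta a h].
- move=> /and3P[t0 c0 b0]; apply/and3P; split.
  + exact: r0 t0.
  + exact: r0 c0.
  + by apply: rel_bp b0; apply: (relM FR); apply: (relX FR).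
- move=> /and3P[t0 c0 b0]; apply/and3P; split.
  + exact: r0 t0.
  + exact: r0 c0.
  + by apply: rel_bp b0; apply: (relM FR); apply: (relX FR).
by move=> b0; apply: rel_bp b0.
Qed.

End InverseRelation.

(** * The inverse as a rational map, and the pushforward of the perturbed form *)

Section RectifyingInverse.
Variables (R : realType) (nf : normal_form R).
Local Notation C := (Cplx R).
Hypothesis ok : nf_ok nf.
Local Notation Rect := (rectifying_map nf).
Local Notation X0 := (tofrac (var R 0)).
Local Notation X1 := (tofrac (var R 1)).
Local Notation cid := (idfun : C -> C).

Lemma rvalue_field_relation (v : plane R) :
  field_relation (@ratconst R) cid (fun f z => rvalue_at f v z).
Proof.
split=> [c|x x' y y' xx yy|x x' y y' xx yy|x x' xx|x x' xx x0].
- exact: rvalue_at_const.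
- exact: rvalue_atD.
- exact: rvalue_atM.
- exact: rvalue_atN.
- exact: rvalue_atV.
Qed.

Lemma rmorph_field_relation (F F' : fieldType) (io : {rmorphism C -> F})
    (g : {rmorphism F -> F'}) (io' : {rmorphism C -> F'}) :
  (forall c, g (io c) = io' c) -> field_relation io io' (fun x y => g x = y).
Proof.
move=> gio; split=> [//|x ? y ? <- <-|x ? y ? <- <-|x ? <-|x ? <- _].
- exact: rmorphD.
- exact: rmorphM.
- exact: rmorphN.
- exact: fmorphV.
Qed.

Lemma exists_notin (T : eqType) (f : nat -> T) (s : seq T) :
  injective f -> exists n, f n \notin s.
Proof.
move=> finj; apply: contrapT => /forallNP h.
have : {subset [seq f n | n <- iota 0 (size s).+1] <= s}.
  by move=> _ /mapP[n _ ->]; have /negP := h n; rewrite negbK.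
move/uniq_leq_size; rewrite map_inj_uniq // iota_uniq size_map size_iota.
by move/(_ isT); rewrite ltnn.
Qed.

Lemma exists_complex_notin (s : seq C) : exists t : C, t \notin s.
Proof.
have [|n ns] := @exists_notin C (fun n => n%:R) s; last by exists n%:R.
by apply: mulrIn; rewrite oner_neq0.
Qed.

(** The finitely many [t] to be removed from the line that parametrizes the good points of
    [{H = c}]. *)
Definition tbad (c : C) : seq C :=
  match nf with
  | NF1 _ _ _ _ _ _ _ beta _ => [:: 0, c & codom beta]
  | NF2 _ _ _ _ _ _ _ beta _ => 0 :: codom beta
  | NF3 _ beta _ _ => codom beta
  end.

(** In the second family [H] is a product of powers of [x], [S] and the [beta_i - G], so no point of
    [{H = 0}] is good. *)
Definition cgood (c : C) : bool :=
  if nf is NF2 _ _ _ _ _ _ _ _ _ then c != 0 else true.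

Lemma betaprod_neq0 n (beta : 'I_n -> C) (a : 'I_n -> nat) t :
  (forall i, (0 < a i)%N) ->
  (betaprod cid beta a t != 0) = (t \notin codom beta).
Proof.
move=> a0; apply/prodf_neq0/idP => [h|tb i _]; last first.
  by rewrite expf_neq0 // subr_eq0; apply: contraNneq tb => <-; exact: codom_f.
apply/negP => /codomP[i tE]; have := h i isT.
by rewrite expf_eq0 a0 tE subrr eqxx.
Qed.

Lemma tgoodE (t c : C) : tgood cid nf t c = (t \notin tbad c) && cgood c.
Proof.
rewrite /tgood /tbad /cgood.
case: nf ok => [r p q p1 q1 k P beta a|r p q p1 q1 k P beta a|r beta a h] /=.
- move=> [_ [_ _ a0] _ _ _]; rewrite betaprod_neq0 // !inE !negb_or andbT.
  by rewrite subr_eq0 [c == t]eq_sym.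
- move=> [_ [_ _ a0] _ _ _]; rewrite betaprod_neq0 // !inE !negb_or.
  by rewrite -andbA [(_ \notin _) && _]andbC.
- by move=> [_ [_ _ a0] _]; rewrite betaprod_neq0 // andbT.
Qed.

Lemma exists_tgood_at c : cgood c -> exists t, tgood cid nf t c.
Proof.
by move=> cg; have [t ht] := exists_complex_notin (tbad c); exists t;
  rewrite tgoodE ht.
Qed.

Lemma exists_tgood : exists t c : C, tgood cid nf t c.
Proof.
have [c] := exists_complex_notin [:: 0]; rewrite inE => c0.
have [|t tg] := @exists_tgood_at c; last by exists t, c.
by rewrite /cgood; case: nf.
Qed.

Definition mkpoint (x y : C) : plane R := \row_j if j == 0 then x else y.

Lemma mkpoint0 x y : mkpoint x y 0 0 = x. Proof. by rewrite mxE. Qed.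
Lemma mkpoint1 x y : mkpoint x y 0 1 = y. Proof. by rewrite mxE. Qed.

Lemma mkpointE (v : plane R) : mkpoint (v 0 0) (v 0 1) = v.
Proof.
by apply/rowP => j; rewrite mxE; case: eqP => [->//|j0]; congr (v 0 _);
  apply/val_inj; case: j j0 => [[|[|]]] //= ? h; case: h; apply/val_inj.
Qed.

Lemma peval_nf_G v : peval (nf_G nf) v = gval cid nf (v 0 0) (v 0 1).
Proof.
have h c : pev v (const c) = cid c by exact: peval_const.
by rewrite [LHS](morph_nf_G h) /= /pev !peval_var.
Qed.

Lemma peval_nf_H v : peval (nf_H nf) v = hval cid nf (v 0 0) (v 0 1).
Proof.
have h c : pev v (const c) = cid c by exact: peval_const.
by rewrite [LHS](morph_nf_H h) /= /pev !peval_var.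
Qed.

Let rvalue_var (v : plane R) i : rvalue_at (tofrac (var R i)) v (v 0 i).
Proof.
rewrite -[X in rvalue_at _ _ X](peval_var v i); exact: rvalue_at_tofrac.
Qed.

Lemma tgood_vars : tgood (@ratconst R) nf X0 X1.
Proof.
have [t [c tg]] := exists_tgood.
apply: (rel_tgood (rvalue_field_relation (mkpoint t c)) _ _ tg).
- by rewrite -[X in rvalue_at _ _ X](mkpoint0 t c).
- by rewrite -[X in rvalue_at _ _ X](mkpoint1 t c).
- exact: rvalue_at_neq0.
Qed.

Lemma good_vars : good (@ratconst R) nf X0 X1.
Proof.
have [t [c tg]] := exists_tgood.
pose x := invx cid nf t c; pose y := invy cid nf t c.
apply: (rel_good (rvalue_field_relation (mkpoint x y)) _ _ _ (tgood_good ok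
  tg)).
- by rewrite -[X in rvalue_at _ _ X](mkpoint0 x y).
- by rewrite -[X in rvalue_at _ _ X](mkpoint1 x y).
- exact: rvalue_at_neq0.
Qed.

Definition rect_inv : ratmap R := \row_i
  if i == 0 then invx (@ratconst R) nf X0 X1 else invy (@ratconst R) nf X0 X1.

Lemma row2E (T : Type) (f : 'I_2 -> T) (P : 'I_2 -> T -> Prop) :
  P 0 (f 0) -> P 1 (f 1) -> forall i, P i (f i).
Proof.
move=> P0 P1 i; have [->//|j0] := eqVneq i 0.
have -> // : i = 1.
by case: i j0 => [[|[|]]] //= ? h; apply/val_inj.
Qed.

Lemma psubst_inv_G : psubst rect_inv (nf_G nf) = X0.
Proof.
rewrite (morph_nf_G (psubst_const rect_inv)) /= !psubst_var !mxE /=.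
exact: (ghvalK ok tgood_vars).1.
Qed.

Lemma psubst_inv_H : psubst rect_inv (nf_H nf) = X1.
Proof.
rewrite (morph_nf_H (psubst_const rect_inv)) /= !psubst_var !mxE /=.
exact: (ghvalK ok tgood_vars).2.
Qed.

(** Substituting [Rect] in [p] gives a polynomial [q], and substituting the inverse in [q] gives [p]
    back. Keeping [q] polynomial matters: [psubst] is always a morphism, whereas [rsubst rect_inv]
    is known to be one only after dominance of the inverse. *)
Lemma rect_dominant p : psubst Rect p = 0 -> p = 0.
Proof.
have [q qE pE] : exists2 q, psubst Rect p = tofrac q
    & psubst rect_inv q = tofrac p.
  elim/bipoly_ind: p => [c|i|p p' [q e1 e2] [q' e1' e2']|p p' [q e1 e2] [q' e1'
    e2']].
  - by exists (const c); rewrite psubst_const.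
  - exists (if i == 0 then nf_G nf else nf_H nf).
      by rewrite psubst_var mxE.
    apply: (@row2E _ (fun i => var R i) (fun i p => psubst rect_inv
      (if i == 0 then nf_G nf else nf_H nf) = tofrac p)) => /=.
      exact: psubst_inv_G.
    exact: psubst_inv_H.
  - by exists (q + q'); rewrite !rmorphD /= ?e1 ?e2 ?e1' ?e2'.
  - by exists (q * q'); rewrite !rmorphM /= ?e1 ?e2 ?e1' ?e2'.
rewrite qE => /eqP; rewrite tofrac_eq0 => /eqP q0.
by move: pE; rewrite q0 rmorph0 => /esym/eqP; rewrite tofrac_eq0 => /eqP.
Qed.

(** The field morphism [rsubst Rect] sends the coordinates to [G] and [H], and commutes with the
    inverse formulas because its graph is a field relation; [invxyK] over the function field
    concludes. *)
Lemma rsubst_rect_inv i : rsubst Rect (rect_inv 0 i) = tofrac (var R i).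
Proof.
have [g gE] := rsubst_rmorphism rect_dominant; rewrite -gE.
have gC c : g (ratconst c) = ratconst c.
  by rewrite gE (rsubst_tofrac rect_dominant) psubst_const.
have gX0 : g X0 = gval (@ratconst R) nf X0 X1.
  rewrite gE (rsubst_tofrac rect_dominant) psubst_var mxE.
  exact: (morph_nf_G (f := @FracField.tofrac (bipoly R))).
have gX1 : g X1 = hval (@ratconst R) nf X0 X1.
  rewrite gE (rsubst_tofrac rect_dominant) psubst_var mxE.
  exact: (morph_nf_H (f := @FracField.tofrac (bipoly R))).
have FR := rmorph_field_relation gC; have tg := good_tgood good_vars.
have [ex ey] := invxyK ok good_vars.
move: i; apply: (@row2E _ (fun i => rect_inv 0 i)
  (fun i f => g f = tofrac (var R i))); rewrite mxE /=.
  by rewrite (rel_invx FR gX0 gX1 tg) ex.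
by rewrite (rel_invy FR gX0 gX1 tg) ey.
Qed.

Lemma rect_inv_dominant p : psubst rect_inv p = 0 -> p = 0.
Proof.
have [g gE] := rsubst_rmorphism rect_dominant => p0.
suff E : g (psubst rect_inv p) = tofrac p.
  by apply/eqP; rewrite -tofrac_eq0 -E p0 rmorph0.
elim/bipoly_ind: {p0} p => [c|i|p q IHp IHq|p q IHp IHq].
- by rewrite psubst_const gE (rsubst_tofrac rect_dominant) psubst_const.
- by rewrite psubst_var gE rsubst_rect_inv.
- by rewrite !rmorphD /= IHp IHq.
- by rewrite !rmorphM /= IHp IHq.
Qed.

Lemma rect_invP : is_ratinv Rect rect_inv.
Proof.
split; apply/rowP => i; rewrite mxE [RHS]mxE; last exact: rsubst_rect_inv.
rewrite [rectifying_map nf 0 i]mxE (rsubst_tofrac rect_inv_dominant).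
apply: (@row2E _ (fun i => var R i) (fun i p => psubst rect_inv
  (if i == 0 then nf_G nf else nf_H nf) = tofrac p)) => /=.
  exact: psubst_inv_G.
exact: psubst_inv_H.
Qed.

(** [ratinv] picks some inverse. Its components and those of [rect_inv] have the same image under
    the field morphism [rsubst Rect], which is injective. *)
Lemma ratinv_rect : ratinv Rect = rect_inv.
Proof.
have [g gE] := rsubst_rmorphism rect_dominant.
have [_ /rowP h] := @xgetPex _ 0 (is_ratinv Rect) (ex_intro _ _ rect_invP).
apply/rowP => i; apply: (fmorph_inj g); rewrite !gE rsubst_rect_inv.
by have := h i; rewrite mxE [RHS]mxE.
Qed.

(** By the chain rule the pushforward of [dH] is the differential of [H] composed with the inverse,
    which is the coordinate [X1]; the constant [eps] is fixed by substitution. *)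
Lemma pushforward_perturbed (theta : 'rV[bipoly R]_2) (eps : C) :
  let vartheta : ratform R := map_mx (fun p => tofrac p) theta in
  form_pushforward Rect
    (differential (tofrac (nf_H nf)) + tofrac (const eps) *: vartheta)
  = differential X1
    + tofrac (const eps) *: form_pushforward Rect vartheta.
Proof.
move=> vartheta; rewrite /form_pushforward ratinv_rect /form_pullback.
apply/rowP => j; rewrite !mxE !summxE mulr_sumr.
rewrite -psubst_inv_H rderiv_psubst -big_split; apply: eq_bigr => i _ /=.
have [g gE] := rsubst_rmorphism rect_inv_dominant.
have gH : g (rderiv i (tofrac (nf_H nf))) = psubst rect_inv (mderiv i (nf_H
  nf)).
  by rewrite gE rderiv_tofrac (rsubst_tofrac rect_inv_dominant).
have geps : g (tofrac (const eps)) = tofrac (const eps).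
  by rewrite gE (rsubst_tofrac rect_inv_dominant) psubst_const.
rewrite !mxE -!gE (rmorphD g) (rmorphM g (tofrac (const eps))) gH geps.
by rewrite mulrDl -mulrA.
Qed.

Lemma rect_inv_value (u : plane R) : tgood cid nf (u 0 0) (u 0 1) ->
  forall i, rvalue_at (rect_inv 0 i) u
    (mkpoint (invx cid nf (u 0 0) (u 0 1)) (invy cid nf (u 0 0) (u 0 1)) 0 i).
Proof.
move=> tg; have FR := rvalue_field_relation u.
apply: (@row2E _ (fun i => rect_inv 0 i) (fun i f => rvalue_at f u
  (mkpoint (invx cid nf (u 0 0) (u 0 1)) (invy cid nf (u 0 0) (u 0 1)) 0 i))).
  by rewrite mkpoint0 mxE; apply: (rel_invx FR).
by rewrite mkpoint1 mxE; apply: (rel_invy FR).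
Qed.

End RectifyingInverse.
(** * Paths in the complex plane *)

Section ComplexPaths.
Variable R : realType.
Local Notation C := (Cplx R).
Local Notation Re := (@complex.Re R).
Local Notation Im := (@complex.Im R).
Implicit Types (f g : R -> C) (s : R).

Lemma ReD (x y : C) : Re (x + y) = Re x + Re y. Proof. by case: x y => [??] [].
  Qed.
Lemma ImD (x y : C) : Im (x + y) = Im x + Im y. Proof. by case: x y => [??] [].
  Qed.
Lemma ReN (x : C) : Re (- x) = - Re x. Proof. by case: x. Qed.
Lemma ImN (x : C) : Im (- x) = - Im x. Proof. by case: x. Qed.
Lemma ReM (x y : C) : Re (x * y) = Re x * Re y - Im x * Im y.
Proof. by case: x y => [??] []. Qed.
Lemma ImM (x y : C) : Im (x * y) = Re x * Im y + Im x * Re y.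
Proof. by case: x y => [??] []. Qed.
Lemma ReV (x : C) : Re x^-1 = Re x / (Re x ^+ 2 + Im x ^+ 2).
Proof. by case: x. Qed.
Lemma ImV (x : C) : Im x^-1 = - (Im x / (Re x ^+ 2 + Im x ^+ 2)).
Proof. by case: x. Qed.
Lemma complexP (x y : C) : Re x = Re y -> Im x = Im y -> x = y.
Proof. by case: x y => [??] [??] /= -> ->. Qed.

Lemma normsq_neq0 (x : C) : x != 0 -> Re x ^+ 2 + Im x ^+ 2 != 0.
Proof.
by apply: contraNneq => /eqP; rewrite paddr_eq0 ?sqr_ge0 // !sqrf_eq0
  => /andP[/eqP h /eqP k]; apply/eqP/complexP.
Qed.

(** Continuity, and below the derivative, in a real parameter are taken on real and imaginary parts,
    the form in which [C1] and [curve_derivative] state them. *)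
Definition ccont f s : Prop :=
  Re (f t) @[t --> s] --> Re (f s) /\ Im (f t) @[t --> s] --> Im (f s).

Definition cder f s (z : C) : Prop :=
  is_derive s 1 (fun t => Re (f t)) (Re z) /\
  is_derive s 1 (fun t => Im (f t)) (Im z).

Lemma ccont_cst (z : C) s : ccont (fun=> z) s.
Proof. by split; apply: cvg_cst. Qed.

Lemma ccontD f g s : ccont f s -> ccont g s -> ccont (fun t => f t + g t) s.
Proof.
move=> [fr fi] [gr gi]; split.
  by under eq_fun do rewrite ReD; rewrite ReD; apply: cvgD.
by under eq_fun do rewrite ImD; rewrite ImD; apply: cvgD.
Qed.

Lemma ccontM f g s : ccont f s -> ccont g s -> ccont (fun t => f t * g t) s.
Proof.
move=> [fr fi] [gr gi]; split.
  by under eq_fun do rewrite ReM; rewrite ReM; apply: cvgB; apply: cvgM.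
by under eq_fun do rewrite ImM; rewrite ImM; apply: cvgD; apply: cvgM.
Qed.

Lemma ccontV f s : f s != 0 -> ccont f s -> ccont (fun t => (f t)^-1) s.
Proof.
move=> /normsq_neq0 f0 [fr fi]; split.
  under eq_fun do rewrite ReV; rewrite ReV; apply: cvgM => //.
  by apply: cvgV => //; apply: cvgD; apply: cvgM.
under eq_fun do rewrite ImV; rewrite ImV; apply: cvgN; apply: cvgM => //.
by apply: cvgV => //; apply: cvgD; apply: cvgM.
Qed.

Lemma near_ccont f g s : (\forall t \near s, f t = g t) -> ccont f s ->
  ccont g s.
Proof.
move=> fg [fr fi]; have fgs := nbhs_singleton fg.
by split; rewrite -fgs; [apply: cvg_trans fr|apply: cvg_trans fi];
  apply: near_eq_cvg; apply: filterS fg => t /= ->.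
Qed.

Lemma ccont_neq0 f s : ccont f s -> f s != 0 -> \forall t \near s, f t != 0.
Proof.
move=> [fr fi] /normsq_neq0 f0.
have : (fun t => Re (f t) ^+ 2 + Im (f t) ^+ 2) @ s
    --> Re (f s) ^+ 2 + Im (f s) ^+ 2.
  by apply: cvgD; apply: cvgM.
move=> /cvgr_neq0 /(_ f0); apply: filterS => t.
by apply: contraNneq => ->; rewrite /= expr0n addr0.
Qed.

Lemma cder_cst (z : C) s : cder (fun=> z) s 0.
Proof. by split; apply: is_derive_cst. Qed.

Lemma cderD f g s x y : cder f s x -> cder g s y ->
  cder (fun t => f t + g t) s (x + y).
Proof.
move=> [fr fi] [gr gi]; split; rewrite ?ReD ?ImD.
  by under eq_fun do rewrite ReD; apply: is_deriveD.
by under eq_fun do rewrite ImD; apply: is_deriveD.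
Qed.

Lemma cderM f g s x y : cder f s x -> cder g s y ->
  cder (fun t => f t * g t) s (x * g s + f s * y).
Proof.
move=> [fr fi] [gr gi]; split.
  under eq_fun do rewrite ReM.
  apply: (is_derive_eq (is_deriveB (is_deriveM fr gr) (is_deriveM fi gi))).
  by rewrite ReD !ReM /GRing.scale /=; ring.
under eq_fun do rewrite ImM.
apply: (is_derive_eq (is_deriveD (is_deriveM fr gi) (is_deriveM fi gr))).
by rewrite ImD !ImM /GRing.scale /=; ring.
Qed.

Lemma is_deriveV_fun (u : R -> R) s du : u s != 0 -> is_derive s 1 u du ->
  is_derive s 1 (fun t => (u t)^-1) (- du / u s ^+ 2).
Proof.
move=> u0 udu; apply: DeriveDef; first by apply: derivableV.
by rewrite deriveV // derive_val /GRing.scale /= mulNr mulNr mulrC.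
Qed.

Lemma cderV f s x : f s != 0 -> cder f s x ->
  cder (fun t => (f t)^-1) s (- x / f s ^+ 2).
Proof.
move=> f0 [fr fi]; have n0 := normsq_neq0 f0.
have dn : is_derive s 1 (fun t => Re (f t) ^+ 2 + Im (f t) ^+ 2)
    (2 * (Re (f s) * Re x + Im (f s) * Im x)).
  apply: (is_derive_eq (is_deriveD (is_deriveM fr fr) (is_deriveM fi fi))).
  by rewrite /GRing.scale /=; ring.
have dV := @is_deriveV_fun (fun t => Re (f t) ^+ 2 + Im (f t) ^+ 2) s _ n0 dn;
  rewrite expr2 invfM.
split.
  under eq_fun do rewrite ReV.
  apply: (is_derive_eq (is_deriveM fr dV)).
  by rewrite !(ReM, ImM, ReN, ImN, ReV, ImV) /GRing.scale /=; field.
under eq_fun do rewrite ImV.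
apply: (is_derive_eq (is_deriveN (is_deriveM fi dV))).
by rewrite !(ReM, ImM, ReN, ImN, ReV, ImV) /GRing.scale /=; field.
Qed.

Lemma cder_uniq f s x y : cder f s x -> cder f s y -> x = y.
Proof.
move=> [xr xi] [yr yi]; apply: complexP.
  by rewrite -(@derive_val _ _ _ _ _ _ _ xr) -(@derive_val _ _ _ _ _ _ _ yr).
by rewrite -(@derive_val _ _ _ _ _ _ _ xi) -(@derive_val _ _ _ _ _ _ _ yi).
Qed.

Lemma cder_ccont f s x : cder f s x -> ccont f s.
Proof.
by move=> [[fr _] [fi _]]; split;
  apply: differentiable_continuous; apply/derivable1_diffP.
Qed.

Lemma near_cder f g s x : (\forall t \near s, f t = g t) -> cder f s x ->
  cder g s x.
Proof.
by move=> fg [fr fi]; split; [apply: near_eq_is_derive fr|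
  apply: near_eq_is_derive fi]; apply: filterS fg => t /= ->.
Qed.

Lemma cder_curve_derivative f s x : cder f s x -> curve_derivative f s = x.
Proof.
by move=> [xr xi]; rewrite /curve_derivative !derive1E !derive_val;
  case: x xr xi.
Qed.

End ComplexPaths.

(** * Polynomials and rational functions along curves in the plane *)

Lemma quotient_rule_sum (F : fieldType) (n' d' w : 'I_2 -> F) (n d : F) :
  d != 0 ->
  \sum_i (n' i * d - n * d' i) / d ^+ 2 * w i =
  (\sum_i n' i * w i) / d + n * (- (\sum_i d' i * w i) / d ^+ 2).
Proof. by move=> d0; rewrite !big_ord_recl !big_ord0; field. Qed.

Section PlanePaths.
Variable R : realType.
Local Notation C := (Cplx R).
Local Notation Re := (@complex.Re R).
Local Notation Im := (@complex.Im R).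

Definition pcont n (al : R -> 'rV[C]_n) s : Prop :=
  forall j, ccont (fun t => al t 0 j) s.

Definition pder n (al : R -> 'rV[C]_n) s (w : 'I_n -> C) : Prop :=
  forall j, cder (fun t => al t 0 j) s (w j).

Lemma pder_pcont n (al : R -> 'rV[C]_n) s w : pder al s w -> pcont al s.
Proof. by move=> alw j; apply: cder_ccont (alw j). Qed.

Lemma eq_ccont (f g : R -> C) s : f =1 g -> ccont f s -> ccont g s.
Proof. by move=> /funext ->. Qed.

Lemma eq_cder (f g : R -> C) s z : f =1 g -> cder f s z -> cder g s z.
Proof. by move=> /funext ->. Qed.

Section Polynomials.
Variables (al : R -> plane R) (s : R).

Lemma ccont_peval (p : bipoly R) : pcont al s ->
  ccont (fun t => peval p (al t)) s.
Proof.
move=> cal; elim/bipoly_ind: p => [c|i|p q IHp IHq|p q IHp IHq].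
- apply: (@eq_ccont (fun=> c)); last exact: ccont_cst.
  by move=> t; rewrite peval_const.
- by apply: (eq_ccont _ (cal i)) => t; rewrite peval_var.
- by apply: (eq_ccont _ (ccontD IHp IHq)) => t; rewrite pevalD.
- by apply: (eq_ccont _ (ccontM IHp IHq)) => t; rewrite pevalM.
Qed.

Lemma cder_peval (p : bipoly R) w : pder al s w ->
  cder (fun t => peval p (al t)) s (\sum_j peval (mderiv j p) (al s) * w j).
Proof.
move=> dal; elim/bipoly_ind: p => [c|i|p q IHp IHq|p q IHp IHq].
- rewrite big1 => [|j _]; last by rewrite mderiv_const peval0 mul0r.
  apply: (@eq_cder (fun=> c)); last exact: cder_cst.
  by move=> t; rewrite peval_const.
- rewrite (bigD1 i) //= mderiv_var eqxx peval1 mul1r big1 ?addr0.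
    by apply: (eq_cder _ (dal i)) => t; rewrite peval_var.
  by move=> j ji; rewrite mderiv_var (negbTE ji) peval0 mul0r.
- under eq_bigr do rewrite mderivD pevalD mulrDl.
  rewrite big_split /=.
  by apply: (eq_cder _ (cderD IHp IHq)) => t; rewrite pevalD.
- have -> : \sum_j peval (mderiv j (p * q)) (al s) * w j =
      (\sum_j peval (mderiv j p) (al s) * w j) * peval q (al s)
      + peval p (al s) * \sum_j peval (mderiv j q) (al s) * w j.
    rewrite mulr_suml mulr_sumr -big_split; apply: eq_bigr => j _ /=.
    rewrite mderivM pevalD (pevalM _ (mderiv j p)) (pevalM _ p) mulrDl.
    by rewrite mulrAC -[in X in _ + X]mulrA.
  by apply: (eq_cder _ (cderM IHp IHq)) => t; rewrite pevalM.
Qed.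

(** The denominator stays nonzero along the curve near [s], so the chosen value [rvalue] is there an
    honest quotient, for which limits and derivatives can be computed. *)
Lemma near_rvalue (n d : bipoly R) : peval d (al s) != 0 -> pcont al s ->
  \forall t \near s,
    peval n (al t) * (peval d (al t))^-1 = rvalue (tofrac n / tofrac d) (al t).
Proof.
move=> d0 cal; have := ccont_neq0 (ccont_peval d cal) d0.
by apply: filterS => t dt; apply/esym/rvalueE; exists n, d.
Qed.

Lemma ccont_rvalue (f : birat R) : regular_at f (al s) -> pcont al s ->
  ccont (fun t => rvalue f (al t)) s.
Proof.
move=> [_ [n [d [d0 -> _]]]] cal; apply: near_ccont (near_rvalue n d0 cal) _.
apply: ccontM; first exact: ccont_peval.
by apply: ccontV => //; apply: ccont_peval.
Qed.

Lemma cder_rvalue (f : birat R) w : regular_at f (al s) -> pder al s w ->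
  cder (fun t => rvalue f (al t)) s (\sum_j rvalue (rderiv j f) (al s) * w j).
Proof.
move=> [_ [n [d [d0 -> _]]]] dal; have cal := pder_pcont dal.
apply: near_cder (near_rvalue n d0 cal) _.
set z := \sum_j _; suff -> : z =
    (\sum_j peval (mderiv j n) (al s) * w j) * (peval d (al s))^-1
    + peval n (al s) * (- (\sum_j peval (mderiv j d) (al s) * w j)
                        / peval d (al s) ^+ 2).
  exact: cderM (cder_peval n dal) (cderV d0 (cder_peval d dal)).
rewrite /z; under eq_bigr do rewrite (rvalueE (rvalue_at_rderiv _ n d0)).
exact: (quotient_rule_sum (fun j => peval (mderiv j n) (al s))
  (fun j => peval (mderiv j d) (al s)) w _ d0).
Qed.

End Polynomials.

Section RealCoordinates.
Variable n : nat.

Lemma cvg_mx (m k : nat) (f : R -> 'M[R]_(m, k)) (s : R) (M : 'M[R]_(m, k)) :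
  (forall i j, f t i j @[t --> s] --> M i j) -> f t @[t --> s] --> M.
Proof.
move=> fM A [P MP PA]; have : \forall t \near s, forall i j, P i j (f t i j).
  apply: (@filter_forall _ _ (fun i t => forall j, P i j (f t i j)) (nbhs s))
    => i.
  apply: (@filter_forall _ _ (fun j t => P i j (f t i j)) (nbhs s)) => j.
  exact: fM (MP i j).
by apply: filterS => t Pt; apply: PA.
Qed.

Lemma real_coordsl (v : 'rV[C]_n) j : real_coords v 0 (lshift n j) = Re (v 0 j).
Proof. by rewrite /real_coords row_mxEl mxE. Qed.

Lemma real_coordsr (v : 'rV[C]_n) j : real_coords v 0 (rshift n j) = Im (v 0 j).
Proof. by rewrite /real_coords row_mxEr mxE. Qed.

Lemma pcont_real_coords (al : R -> 'rV[C]_n) s : pcont al s ->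
  real_coords (al t) @[t --> s] --> real_coords (al s).
Proof.
move=> cal; apply: cvg_mx => i j; rewrite !ord1.
case: (split_ordP j) => k ->.
  by under eq_fun do rewrite real_coordsl; rewrite real_coordsl;
    exact: (cal k).1.
by under eq_fun do rewrite real_coordsr; rewrite real_coordsr; exact: (cal k).2.
Qed.

Lemma real_coords_pcont (al : R -> 'rV[C]_n) s :
  real_coords (al t) @[t --> s] --> real_coords (al s) -> pcont al s.
Proof.
move=> cal j; split.
  have := cvg_comp _ _ cal (@coord_continuous _ _ _ 0 (lshift n j) _).
  by rewrite /comp; under eq_fun do rewrite real_coordsl; rewrite real_coordsl.
have := cvg_comp _ _ cal (@coord_continuous _ _ _ 0 (rshift n j) _).
by rewrite /comp; under eq_fun do rewrite real_coordsr; rewrite real_coordsr.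
Qed.

Lemma derivable_coord m k (f : R -> 'M[R]_(m, k)) s i j :
  derivable f s 1 -> derivable (fun t => f t i j) s 1.
Proof.
move=> /cvg_ex[l fl]; apply/cvg_ex; exists (l i j).
have := cvg_comp _ _ fl (@coord_continuous _ _ _ i j l).
by apply: cvg_trans; apply: near_eq_cvg; near=> h; rewrite /= !mxE.
Unshelve. all: by end_near. Qed.

Lemma real_coords_pder (al : R -> 'rV[C]_n) s :
  derivable (fun t => real_coords (al t)) s 1 -> exists w, pder al s w.
Proof.
move=> dal; exists (fun j => Complex ('D_1 (fun t => Re (al t 0 j)) s)
  ('D_1 (fun t => Im (al t 0 j)) s)) => j.
split; apply: derivableP.
  have := @derivable_coord _ _ _ _ 0 (lshift n j) dal.
  by under eq_fun do rewrite real_coordsl.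
have := @derivable_coord _ _ _ _ 0 (rshift n j) dal.
by under eq_fun do rewrite real_coordsr.
Qed.

End RealCoordinates.

End PlanePaths.
(** * Reducible fibers lie over bifurcation values *)

Section NonTriviality.
Variable R : realType.
Local Notation C := (Cplx R).
Local Notation Re := (@complex.Re R).
Local Notation Im := (@complex.Im R).

Definition rc (t : R) : C := Complex t 0.

Lemma cder_rc s : cder rc s 1.
Proof. by split; [apply: is_derive_id|apply: is_derive_cst]. Qed.

Lemma rc_inj : injective rc. Proof. by move=> t t' []. Qed.

Lemma open_real_segment (U : set C) c : open U -> U c ->
  exists2 e : R, 0 < e & forall t, `|t| < e -> U (c + rc t).
Proof.
move=> oU Uc; have /nbhs_ballP[e /= e0 eU] : nbhs c U by exact: open_nbhs_nbhs.
(* The radius is a positive complex number for the order of [C], hence has zero imaginary part. *)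
case: e e0 eU => e e' /andP[/eqP /= e'0 e0] eU; exists e => // t te.
apply: eU; rewrite /ball /= opprD addNKr normrN.
by rewrite [`|_|]/Num.norm /= expr0n /= addr0 sqrtr_sqr ltcE /= e'0 eqxx.
Qed.

Section Trivial.
Variables (H : bipoly R) (c0 : C) (U : set C).
Hypotheses (oU : open U) (Uc0 : U c0) (trivH : smoothly_trivial_over H c0 U).
Variables (A B : bipoly R).
Hypothesis HAB : H = const c0 + A * B.

Lemma factors_fiber v : fiber H c0 v -> peval A v * peval B v = 0.
Proof.
rewrite /fiber /= HAB pevalD peval_const pevalM => /eqP.
by rewrite -subr_eq0 addrAC subrr add0r => /eqP.
Qed.

(* A common zero of A and B would be a critical point of H, but H has
   derivative 1 along a curve lifting c0 + t. *)
Lemma no_common_zero v : peval A v = 0 -> peval B v = 0 -> False.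
Proof.
move=> Av Bv.
have Hv : peval H v = c0 by rewrite HAB pevalD peval_const pevalM Av mul0r
  addr0.
have [e e0 eU] := open_real_segment oU Uc0.
have [pi [psi [psiK piK _ psiS]]] := trivH.
have [piv psiv] : fiber H c0 (pi v) /\ psi (cpair c0 (pi v)) = v.
  by have := psiK v; rewrite Hv; apply.
have [W [F [oW Wx Fk FE]]] := psiS _
  (ex_intro _ c0 (ex_intro _ (pi v) (And3 Uc0 piv (erefl _)))).
pose x0 := real_coords (cpair c0 (pi v)).
(* Only the value coordinate moves, at unit real speed; the point [pi v] of the fiber stays
   fixed. *)
pose dir := real_coords (cpair (1 : C) (0 : plane R)).
have [_ /(_ dir) [dF _]] := Fk 1%N.
pose al t := psi (cpair (c0 + rc t) (pi v)).
have lineE t : real_coords (cpair (c0 + rc t) (pi v)) = t *: dir + x0.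
  apply/rowP => j; rewrite !mxE; case: splitP => k _; rewrite !mxE;
    case: splitP => l _; rewrite !mxE ?(ord1, eqxx, mulr1n) /=.
  - by rewrite ReD /= mulr1 addrC.
  - by rewrite mulr0 add0r.
  - by rewrite ImD /= mulr0 addrC addr0.
  - by rewrite mulr0 add0r.
have nearU : \forall t \near (0 : R), `|t| < e.
  apply/nbhs_ballP; exists e => // t; rewrite /ball /= sub0r normrN.
  by [].
have nearW : \forall t \near (0 : R), W (t *: dir + x0).
  have : (t *: dir + x0) @[t --> (0 : R)] --> 0 *: dir + x0.
    by apply: cvgD; [apply: cvgZr_tmp => //; apply: cvg_id|apply: cvg_cst].
  by apply; apply: open_nbhs_nbhs; split => //; rewrite scale0r add0r.
(* Smoothness of [psi] is given through a local extension [F]; the lifted curve is differentiable at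
   0 because it agrees with [F] on a line. *)
have nearF : \forall t \near (0 : R), F (t *: dir + x0) = real_coords (al t).
  apply: filterS2 nearU nearW => t te; rewrite -lineE => Wt; apply: FE => //.
  by exists (c0 + rc t), (pi v); split=> //; apply: eU.
have [w dal] : exists w, pder al 0 w.
  apply: real_coords_pder; apply: near_eq_derivable nearF _.
  exact: (derivable1P F x0 dir).1 (dF x0 Wx).
have al0 : al 0 = v.
  by rewrite /al (_ : rc 0 = 0) ?addr0.
have := cderM (cder_peval A dal) (cder_peval B dal).
rewrite al0 Av Bv mulr0 mul0r addr0 => d0.
suff d1 : cder (fun t => peval A (al t) * peval B (al t)) 0 1.
  by have /eqP := cder_uniq d0 d1; rewrite eq_sym oner_eq0.
apply: near_cder (cder_rc 0); apply: filterS nearU => t te.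
have [Hal _] := piK (c0 + rc t) (pi v) (eU _ te) piv.
move: Hal; rewrite -/(al t) /fiber /= HAB pevalD peval_const pevalM.
by move/addrI.
Qed.

Lemma pi_pcont (pi : plane R -> plane R) (ga : R -> plane R) s :
  smooth_on [set v | U (peval H v)] pi -> (forall t, U (peval H (ga t))) ->
  pcont ga s -> pcont (fun t => pi (ga t)) s.
Proof.
move=> piS Uga cga; apply: real_coords_pcont.
have [W [F [oW Wx Fk FE]]] := piS (ga s) (Uga s).
have [cF _] := Fk 0%N; rewrite -FE //.
have cFg := cvg_comp _ _ (pcont_real_coords cga) (cF _ Wx).
apply: cvg_trans cFg; apply: near_eq_cvg.
have : \forall t \near s, W (real_coords (ga t)).
  by apply: (pcont_real_coords cga); apply: open_nbhs_nbhs.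
by apply: filterS => t Wt; rewrite /= FE //; apply: Uga.
Qed.

Definition path_in (D : set (plane R)) (v w : plane R) : Prop :=
  exists ga : R -> plane R, [/\ forall s, pcont ga s, ga 0 = v, ga 1 = w
    & forall s, D (ga s)].

(** The zeros [v0] of [A] and [w0] of [B] are moved by the trivialization to a nearby connected
    fiber, joined there, and the path is brought back by [pi]. Along it [|A|^2 - |B|^2] changes
    sign; where it vanishes, [A B = 0] forces both factors to vanish. *)
Lemma reducible_fiber_not_trivial (bad : seq C) v0 w0 :
  (forall c, c \notin bad -> forall v w, fiber H c v -> fiber H c w ->
     path_in (fiber H c) v w) ->
  peval A v0 = 0 -> peval B w0 = 0 -> False.
Proof.
move=> conn Av0 Bw0.
have Hv0 : fiber H c0 v0.
  by rewrite /fiber /= HAB pevalD peval_const pevalM Av0 mul0r addr0.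
have Hw0 : fiber H c0 w0.
  by rewrite /fiber /= HAB pevalD peval_const pevalM Bw0 mulr0 addr0.
have [e e0 eU] := open_real_segment oU Uc0.
have [pi [psi [psiK piK piS _]]] := trivH.
(* Infinitely many values of the segment are available for finitely many bad ones; a denominator of
   at least 2 keeps the displacement strictly below [e]. *)
have [n nbad] : exists n : nat, c0 + rc (e / n.+2%:R) \notin bad.
  apply: exists_notin => n m /addrI/rc_inj/(mulfI (lt0r_neq0 e0))/invr_inj.
  by move/(mulrIn (oner_neq0 _)) => -[].
set c := c0 + _ in nbad.
have Uc : U c.
  apply: eU; rewrite ger0_norm ?divr_ge0 ?ltW //.
  by rewrite ltr_pdivrMr // ltr_pMr // ltr1n.
have [Hv pv] := piK c v0 Uc Hv0; have [Hw pw] := piK c w0 Uc Hw0.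
have [ga [cga ga0 ga1 Hga]] := conn c nbad _ _ Hv Hw.
pose be s := pi (ga s).
have Uga s : U (peval H (ga s)) by rewrite Hga.
have cbe s : pcont be s by apply: pi_pcont.
have Hbe s : fiber H c0 (be s) by have [] := psiK _ (Uga s).
pose nsq (x : C) := Re x ^+ 2 + Im x ^+ 2.
pose phi s := nsq (peval A (be s)) - nsq (peval B (be s)).
have cphi : continuous phi.
  move=> s; have [aR aI] := ccont_peval A (cbe s).
  have [bR bI] := ccont_peval B (cbe s).
  exact: (cvgB (cvgD (cvgM aR aR) (cvgM aI aI)) (cvgD (cvgM bR bR) (cvgM bI
    bI))).
have nsq_ge0 x : 0 <= nsq x by rewrite addr_ge0 ?sqr_ge0.
have nsq0 : nsq 0 = 0 by rewrite /nsq /= expr0n addr0.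
have phi0 : phi 0 <= 0.
  by rewrite /phi /be ga0 pv Av0 nsq0 sub0r oppr_le0.
have phi1 : 0 <= phi 1 by rewrite /phi /be ga1 pw Bw0 nsq0 subr0.
have [||s _ phis] := @IVT _ phi 0 1 0 ler01.
- exact: continuous_subspaceT.
- by rewrite ge_min phi0 le_max phi1 orbT.
have [As Bs] : peval A (be s) = 0 /\ peval B (be s) = 0.
  have nsq_eq0 x : nsq x = 0 -> x = 0.
    by move=> x0; apply/eqP; apply: contraT => /normsq_neq0;
      rewrite -/(nsq x) x0 eqxx.
  move/eqP: phis; rewrite subr_eq0 => /eqP nE.
  have /eqP := factors_fiber (Hbe s); rewrite mulf_eq0 => /orP[] /eqP E.
    by split=> //; apply: nsq_eq0; rewrite -nE E.
  by split=> //; apply: nsq_eq0; rewrite nE E.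
exact: no_common_zero As Bs.
Qed.

End Trivial.

End NonTriviality.

(** * Path connectedness of the fibers over all but finitely many values *)

Section GenericFibers.
Variable R : realType.
Local Notation C := (Cplx R).
Local Notation cid := (idfun : C -> C).
Local Notation Re := (@complex.Re R).
Local Notation Im := (@complex.Im R).

Lemma path_avoiding (s : seq C) (a b : C) : a \notin s -> b \notin s ->
  exists tau : R -> C,
    [/\ forall t, ccont tau t, tau 0 = a, tau 1 = b & forall t, tau t \notin s].
Proof.
move=> as_ bs; have [<-|ab] := eqVneq a b.
  by exists (fun=> a); split=> // t; apply: ccont_cst.
have d0 : b - a != 0 by rewrite subr_eq0 eq_sym.
(* The parabola through 0 and 1 of height parameter m meets each forbidden
   value for at most one m. *)
pose z x : C := (x - a) / (b - a).
pose mu x : R := Im (z x) / (Re (z x) * (1 - Re (z x))).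
have [m mbad] := @exists_notin _ (fun m => m%:R) [seq mu x | x <- s]
  (mulrIn (oner_neq0 R)).
pose par t : C := Complex t (m%:R * (t * (1 - t))).
exists (fun t => a + (b - a) * par t); split.
- move=> t; apply: ccontD; first exact: ccont_cst.
  apply: ccontM; first exact: ccont_cst.
  split; first exact: cvg_id.
  apply: cvgM; first exact: cvg_cst.
  by apply: cvgM; [exact: cvg_id|apply: cvgB; [exact: cvg_cst|exact: cvg_id]].
- have -> : par 0 = 0 by rewrite /par mul0r mulr0.
  by rewrite mulr0 addr0.
- have -> : par 1 = 1 by rewrite /par subrr !mulr0.
  by rewrite mulr1 addrC subrK.
move=> t; apply/negP => ts.
have zE : z (a + (b - a) * par t) = par t.
  by rewrite /z addrAC subrr add0r mulrC mulKf.
(* At the end points the quotient [mu] has zero denominator, but there the path is at [a] or [b],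
   which are allowed. *)
have [t0|t0] := eqVneq t 0.
  move: ts; have -> : par t = 0 by rewrite /par t0 mul0r mulr0.
  by rewrite mulr0 addr0 (negbTE as_).
have [t1|t1] := eqVneq t 1.
  move: ts; have -> : par t = 1 by rewrite /par t1 subrr !mulr0.
  by rewrite mulr1 addrC subrK (negbTE bs).
move/negP: mbad; apply; apply/mapP; exists (a + (b - a) * par t) => //.
rewrite /mu zE /= mulfK //.
by rewrite mulf_neq0 // subr_eq0 eq_sym.
Qed.

Section ModFactor.
Variable A : bipoly R.

(** Congruence of [f] to a constant modulo [A]. Computing with it shows that [A] divides [H - e]
    while the cofactor is never written down. *)
Definition congr_mod (f : bipoly R) (e : C) : Prop :=
  exists B, f = const e + A * B.

Lemma congr_modC c : congr_mod (const c) c.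
Proof. by exists 0; rewrite mulr0 addr0. Qed.

Lemma congr_mod_self : congr_mod A 0.
Proof. by exists 1; rewrite rmorph0 add0r mulr1. Qed.

Lemma congr_modD f g x y :
  congr_mod f x -> congr_mod g y -> congr_mod (f + g) (x + y).
Proof.
move=> [B ->] [B' ->]; exists (B + B').
by rewrite rmorphD mulrDr addrACA.
Qed.

Lemma congr_modN f x : congr_mod f x -> congr_mod (- f) (- x).
Proof. by move=> [B ->]; exists (- B); rewrite rmorphN opprD mulrN. Qed.

Lemma congr_modM f g x y :
  congr_mod f x -> congr_mod g y -> congr_mod (f * g) (x * y).
Proof.
move=> [B ->] [B' ->]; exists (B * const y + const x * B' + A * B * B').
by rewrite rmorphM /=; ring.
Qed.

Lemma congr_mod0M f g : congr_mod f 0 -> congr_mod (f * g) 0.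
Proof.
by move=> [B ->]; exists (B * g); rewrite rmorph0 !add0r mulrA.
Qed.

Lemma congr_modM0 f g : congr_mod g 0 -> congr_mod (f * g) 0.
Proof. by rewrite mulrC; apply: congr_mod0M. Qed.

Lemma congr_modX f x n : congr_mod f x -> congr_mod (f ^+ n) (x ^+ n).
Proof.
move=> fx; elim: n => [|n IHn]; last by rewrite !exprS; apply: congr_modM.
by rewrite !expr0; have := congr_modC 1; rewrite rmorph1.
Qed.

Lemma congr_mod_poly_in_x (P : {poly C}) x :
  congr_mod (var R 0) x -> congr_mod (poly_in_x P) P.[x].
Proof.
move=> xx; rewrite /poly_in_x.
elim/poly_ind: P => [|P c IHP].
  by rewrite !rmorph0 !horner0; have := congr_modC 0; rewrite rmorph0.
rewrite !rmorphD !rmorphM /= map_polyX map_polyC !hornerE.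
by apply: congr_modD; [apply: congr_modM|apply: congr_modC].
Qed.

Lemma congr_mod_beta_prod n (beta : 'I_n -> C) a g x : congr_mod g x ->
  congr_mod (beta_prod beta a g) (\prod_(i < n) (beta i - x) ^+ a i).
Proof.
move=> gx; apply: (big_ind2 congr_mod) => [|f y f' y'|i _].
- by have := congr_modC 1; rewrite rmorph1.
- exact: congr_modM.
apply/congr_modX/congr_modD; first exact: congr_modC.
exact: congr_modN.
Qed.

End ModFactor.

Lemma congr_mod_beta_prod0 n (beta : 'I_n -> C) (a : 'I_n -> nat) g i :
  (0 < a i)%N -> congr_mod (const (beta i) - g) (beta_prod beta a g) 0.
Proof.
move=> ai; rewrite /beta_prod (bigD1 i) //=; apply: congr_mod0M.
by rewrite -(prednK ai) exprS; apply: congr_mod0M; apply: congr_mod_self.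
Qed.

Variable nf : normal_form R.
Hypothesis ok : nf_ok nf.
Local Notation H := (nf_H nf).

Lemma fiber_nf_H c (v : plane R) : fiber H c v <-> hval cid nf (v 0 0) (v 0 1)
  = c.
Proof. by rewrite /fiber /= peval_nf_H. Qed.

Lemma good_paths c (v w : plane R) : good cid nf (v 0 0) (v 0 1) ->
  good cid nf (w 0 0) (w 0 1) -> fiber H c v -> fiber H c w ->
  path_in (fiber H c) v w.
Proof.
move=> gv gw /fiber_nf_H Hv /fiber_nf_H Hw.
have [tv tw] := (good_tgood gv, good_tgood gw).
have [xv yv] := invxyK ok gv; have [xw yw] := invxyK ok gw.
rewrite Hv in tv xv yv; rewrite Hw in tw xw yw.
move: (tv) (tw); rewrite !(tgoodE ok) => /andP[tvb cg] /andP[twb _].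
have [tau [ctau tau0 tau1 taub]] := path_avoiding tvb twb.
have tg t : tgood cid nf (tau t) c by rewrite (tgoodE ok) taub.
(* The lifted path consists of values of the rational map [rect_inv] at regular points, whence its
   continuity. *)
have valE t i : rvalue (rect_inv nf 0 i) (mkpoint (tau t) c) =
    mkpoint (invx cid nf (tau t) c) (invy cid nf (tau t) c) 0 i.
  apply: rvalueE; have := @rect_inv_value _ nf (mkpoint (tau t) c).
  by rewrite mkpoint0 mkpoint1; apply.
exists (fun t => mkpoint (invx cid nf (tau t) c) (invy cid nf (tau t) c));
  split.
- move=> s j; apply: (eq_ccont (fun t => valE t j)).
  apply: (@ccont_rvalue _ (fun t => mkpoint (tau t) c)).
    eexists; have := @rect_inv_value _ nf (mkpoint (tau s) c).
    by rewrite mkpoint0 mkpoint1; apply.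
  move=> k; have [k0|k0] := eqVneq k 0.
    by apply: (eq_ccont _ (ctau s)) => t; rewrite k0 mkpoint0.
  by apply: (eq_ccont _ (ccont_cst c s)) => t; rewrite mxE (negbTE k0).
- by rewrite tau0 xv yv mkpointE.
- by rewrite tau1 xw yw mkpointE.
by move=> s; apply/fiber_nf_H; rewrite mkpoint0 mkpoint1;
  case: (ghvalK ok (tg s)).
Qed.

(** The values of [H] at points that are not good: [H(0,0)] on [x = 0], where [S] does not depend on
    [y] because [k >= 1]; 0 on [S = 0]; on [G = beta_i], the value [beta_i] in the first family, 0
    in the second and [h(beta_i)] in the third. *)
Definition special_values : seq C :=
  match nf with
  | NF1 _ _ _ _ _ _ _ beta _ => [:: 0, hval cid nf 0 0 & codom beta]
  | NF2 _ _ _ _ _ _ _ _ _ => [:: 0; hval cid nf 0 0]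
  | NF3 _ beta _ h => [seq h.[b] | b <- codom beta]
  end.

Lemma skel_x0 k P (y : C) : (1 <= k)%N -> skel cid k P 0 y = skel cid k P 0 0.
Proof. by move=> k0; rewrite /skel expr0n gtn_eqF // !mul0r. Qed.

Lemma not_good_special (x y : C) : ~~ good cid nf x y ->
  hval cid nf x y \in special_values.
Proof.
rewrite /good /special_values.
case: nf ok => [r p q p1 q1 k P beta a|r p q p1 q1 k P beta a|r beta a h].
- move=> [_ [_ _ a0] [p0 q0 _] k0 _]; rewrite !negb_and !negbK.
  case/or3P => [/eqP ->|/eqP s0|].
  + by rewrite /= skel_x0 // !inE eqxx orbT.
  + by rewrite /= s0 -(ltn_predK p0) -(ltn_predK q0) !exprS !mul0r !mulr0 mul0r
      addr0 inE eqxx.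
  + move=> b0; have b0' := b0; move: b0'.
    rewrite -[_ == 0]negbK betaprod_neq0 // negbK => bG.
    by rewrite /= (eqP b0) mulr0 addr0 !inE bG !orbT.
- move=> [_ [_ _ a0] [p0 q0 _] k0 _]; rewrite !negb_and !negbK.
  case/or3P => [/eqP ->|/eqP s0|/eqP b0].
  + by rewrite /= skel_x0 // !inE eqxx orbT.
  + by rewrite /= s0 -(ltn_predK p0) exprS mul0r mulr0 mul0r inE eqxx.
  + by rewrite /= b0 mulr0 inE eqxx.
move=> [_ [_ _ a0] _]; rewrite betaprod_neq0 // negbK => xb.
rewrite /= (_ : betaprod _ _ _ _ = 0) ?mulr0 ?add0r; last first.
  by apply/eqP; rewrite -[_ == 0]negbK betaprod_neq0 // negbK.
by rewrite map_poly_id //; apply: map_f.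
Qed.

Lemma generic_fiber_paths c : c \notin special_values -> forall v w,
  fiber H c v -> fiber H c w -> path_in (fiber H c) v w.
Proof.
move=> cs v w Hv Hw; apply: good_paths => //.
  by apply: contraT => /not_good_special; have /fiber_nf_H -> := Hv;
    rewrite (negbTE cs).
by apply: contraT => /not_good_special; have /fiber_nf_H -> := Hw;
  rewrite (negbTE cs).
Qed.

End GenericFibers.

(** * Points over generic values are good *)

Section GenericGood.
Variable R : realType.
Local Notation C := (Cplx R).
Local Notation cid := (idfun : C -> C).

(** The smallest set is an intersection, so a value outside it is missed by some admissible finite
    set, and triviality near the value comes from that set. *)
Lemma generic_trivial (H : bipoly R) (c : C) : ~ bifurcation_set H c ->
  exists U, [/\ open U, U c & smoothly_trivial_over H c U].
Proof.
move=> nb; suff [A [_ fA] nA] : exists2 A,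
    finite_set A /\ smooth_fibration_outside H A & ~ A c by exact: fA.
apply: contrapT => /forall2NP h; apply: nb => A [[fA sA] _].
by case: (h A) => [nh|/contrapT//]; case: nh.
Qed.

Lemma peval_skeleton k P (v : plane R) :
  peval (skeleton k P) v = skel cid k P (v 0 0) (v 0 1).
Proof.
have h c : pev v (const c) = cid c by exact: peval_const.
by rewrite [LHS](morph_skeleton h) /= /pev !peval_var.
Qed.

Lemma congr_mod_var0_skeleton k (P : {poly C}) : (1 <= k)%N ->
  congr_mod (var R 0) (skeleton k P) P.[0].
Proof.
move=> k0; rewrite -[P.[0]]add0r; apply: congr_modD.
  rewrite -(prednK k0) exprS; do 2 apply: congr_mod0M.
  exact: congr_mod_self.
by apply/congr_mod_poly_in_x/congr_mod_self.
Qed.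

Lemma congr_mod_skeleton_xS k (P : {poly C}) m n : (0 < n)%N ->
  congr_mod (skeleton k P) (xS k P m n) 0.
Proof.
move=> n0; apply: congr_modM0; rewrite -(prednK n0) exprS.
by apply: congr_mod0M; apply: congr_mod_self.
Qed.

Lemma congr_mod_const_sub (b : C) (g : bipoly R) : congr_mod (const b - g) g b.
Proof. by exists (-1); rewrite mulrN1 opprB addrC subrK. Qed.

Lemma congr_mod_xS A k (P : {poly C}) m n x s :
  congr_mod A (var R 0) x -> congr_mod A (skeleton k P) s ->
  congr_mod A (xS k P m n) (x ^+ m * s ^+ n).
Proof. by move=> xx ss; apply: congr_modM; apply: congr_modX. Qed.

Variable nf : normal_form R.
Hypothesis ok : nf_ok nf.
Local Notation H := (nf_H nf).

Section Trivial.
Variables (c : C) (U : set C).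
Hypotheses (oU : open U) (Uc : U c) (tU : smoothly_trivial_over H c U).

(** The zero [v] of [A] identifies the constant [e] with [c], and a point [w] of the same fiber off
    [{A = 0}] must be a zero of the cofactor. *)
Lemma proper_factor_not_trivial (A : bipoly R) e (v w : plane R) :
  congr_mod A H e -> peval A v = 0 -> fiber H c v -> fiber H c w ->
  peval A w != 0 -> False.
Proof.
move=> [B HAB] Av Hv Hw Aw.
have ec : e = c.
  by rewrite -Hv HAB pevalD pevalM Av mul0r addr0 peval_const.
rewrite ec in HAB; have /eqP := factors_fiber HAB Hw.
rewrite mulf_eq0 (negbTE Aw) /= => /eqP Bw.
exact: (reducible_fiber_not_trivial oU Uc tU HAB
  (generic_fiber_paths ok) Av Bw).
Qed.

(** A good point lies off all the factors considered, and so is the point [w] that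
    [proper_factor_not_trivial] asks for. *)
Lemma good_witness : cgood nf c -> exists2 w : plane R, fiber H c w &
  good cid nf (w 0 0) (w 0 1).
Proof.
move=> /(exists_tgood_at ok)[t tg].
exists (mkpoint (invx cid nf t c) (invy cid nf t c)).
  by apply/fiber_nf_H; rewrite mkpoint0 mkpoint1; case: (ghvalK ok tg).
by rewrite mkpoint0 mkpoint1; apply: tgood_good.
Qed.

End Trivial.

Lemma peval_const_sub_G b (v : plane R) :
  peval (const b - nf_G nf) v = b - gval cid nf (v 0 0) (v 0 1).
Proof. by rewrite pevalB peval_const peval_nf_G. Qed.

Lemma generic_good c (v : plane R) : ~ bifurcation_set H c ->
  ~ contracted_values nf c -> fiber H c v -> good cid nf (v 0 0) (v 0 1).
Proof.
move=> /generic_trivial[U [oU Uc tU]] nc Hv; apply: contraT => ng; exfalso.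
have no_factor A e := @proper_factor_not_trivial c U oU Uc tU A e v.
have witness := @good_witness c.
have GE := peval_const_sub_G.
have HE := fun u => fiber_nf_H nf c u.
move: ng (Hv) no_factor witness GE HE nc; clear Hv.
have okk := ok; move: okk oU Uc tU.
case: nf => [r p q p1 q1 k P beta a|r p q p1 q1 k P beta a|r beta a h].
- move=> [_ [_ _ a0] [p0 q0 _] k0 _] oU Uc tU ng Hv no_factor witness GE HE _.
  have [|w Hw] := witness; first by [].
  move=> /and3P[xw sw bw].
  move: ng; rewrite !negb_and !negbK => /or3P[/eqP x0|/eqP s0|].
  + apply: (no_factor (var R 0) _ w _ _ Hv Hw); rewrite ?peval_var //.
    (* Modulo [x], the skeleton is the constant [P(0)], hence [H] is constant too. *)
    have S0 := congr_mod_var0_skeleton P k0.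
    apply: congr_modD; first by apply: congr_mod_xS S0; apply: congr_mod_self.
    apply: congr_modM; first by apply: congr_mod_xS S0; apply: congr_mod_self.
    by apply: congr_mod_beta_prod; apply: congr_mod_xS S0;
      apply: congr_mod_self.
  + apply: (no_factor (skeleton k P) _ w _ _ Hv Hw); rewrite ?peval_skeleton //.
    apply: congr_modD; first exact: congr_mod_skeleton_xS (leq_ltn_trans _ q0).
    apply: congr_mod0M; exact: congr_mod_skeleton_xS (leq_ltn_trans _ p0).
  + move=> /eqP b0; move: bw; rewrite betaprod_neq0 // => bw.
    have : ~~ (betaprod cid beta a (gval cid (NF1 p q p1 q1 k P beta a)
      (v 0 0) (v 0 1)) != 0) by rewrite negbK b0.
    rewrite betaprod_neq0 // negbK => /codomP[i Gi].
    apply: (no_factor (const (beta i) - nf_G (NF1 p q p1 q1 k P beta a)) _ w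
      _ _ Hv Hw); rewrite ?GE ?Gi ?subrr //.
      (* Modulo [beta i - G], the first term of [H] is the constant [beta i] and the second one is
         0. *)
      apply: congr_modD; first exact: congr_mod_const_sub.
      by apply: congr_modM0; apply: congr_mod_beta_prod0.
    by rewrite subr_eq0; apply: contraNneq bw => <-; apply: codom_f.
- move=> ok2 oU Uc tU ng Hv no_factor witness GE HE nc.
  have [r0 [_ b0 a0] det1 k0 _] := ok2; have [p0 q0 _] := det1.
  pose nf2 := NF2 p q p1 q1 k P beta a.
  (* As [{H = 0}] has no good point, this zero of [S] replaces the good witness: [x = 1] there, and
     [G = 0] differs from every [beta_i]. *)
  pose w1 := mkpoint 1 (- P.[1]).
  have s1 : skel cid k P (w1 0 0) (w1 0 1) = 0.
    by rewrite mkpoint0 mkpoint1 /skel expr1n mul1r map_poly_id // addNr.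
  have H1 : c = 0 -> fiber (nf_H nf2) c w1.
    by move=> c0; apply/HE; rewrite /= s1 -(ltn_predK p0) exprS mul0r mulr0
      mul0r.
  move: ng; rewrite !negb_and !negbK => /or3P[/eqP x0|/eqP s0|].
  + have [w Hw xw] : exists2 w, fiber (nf_H nf2) c w & w 0 0 != 0.
      have [c0|c0] := eqVneq c 0.
        by exists w1; [exact: H1|rewrite mkpoint0 oner_neq0].
      by have [//|w Hw /and3P[xw _ _]] := witness; exists w.
    apply: (no_factor (var R 0) _ w _ _ Hv Hw); rewrite ?peval_var //.
    have S0 := congr_mod_var0_skeleton P k0.
    apply: congr_modM; first by apply: congr_mod_xS S0; apply: congr_mod_self.
    by apply: congr_mod_beta_prod; apply: congr_mod_xS S0;
      apply: congr_mod_self.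
  + have c0 : c = 0.
      have /HE <- := Hv.
      by rewrite /= s0 -(ltn_predK p0) exprS mul0r mulr0 mul0r.
    pose B := var R 0 ^+ p1 * skeleton k P ^+ p.-1
              * beta_prod beta a (xS k P q1 q).
    have HAB : nf_H nf2 = const c + skeleton k P * B.
      rewrite c0 rmorph0 add0r /nf2 /= /B {1}/xS -{1}(ltn_predK p0) exprS.
      by rewrite [var R 0 ^+ p1 * (_ * _)]mulrCA -!mulrA.
    (* If [p >= 2], the cofactor still contains [S] and vanishes at [v] itself. If [p = 1], a beta
       factor must supply the zero; there is none exactly when [r = 1], the contracted case. *)
    have [w Bw] : exists w, peval B w = 0.
      have [p2|p2] := ltnP 1 p.
        exists v; rewrite !pevalM pevalX pevalX peval_skeleton s0.
        by rewrite -(subnKC p2) exprS mul0r mulr0 mul0r.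
      have p_1 : p = 1%N by apply/eqP; rewrite eqn_leq p2 (leq_ltn_trans _ p0).
      case: (posnP r.-1) => r1.
        case: nc; split=> //; apply/eqP; rewrite eqn_leq r0 andbT.
        by rewrite -subn_eq0 subn1 r1.
      pose i := Ordinal r1; have bi := b0 i.
      (* The monomial inverse at the point with coordinates [beta i] and 1 gives nonzero [x] and [s]
         with [x^q1 s^q = beta i]; solving [S = s] for [y] yields a point where [G = beta i]. *)
      have [xG _] := mon_tu (exponents_unimodular det1) bi (oner_neq0 C).
      set x := monx _ _ _ _ _ in xG; set s := mons _ _ _ _ _ in xG.
      have xn0 : x != 0 by apply: monx_neq0 => //; apply: oner_neq0.
      exists (mkpoint x ((s - (map_poly cid P).[x]) / x ^+ k)).
      rewrite pevalM; suff -> : peval (beta_prod beta a (xS k P q1 q))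
        (mkpoint x ((s - (map_poly cid P).[x]) / x ^+ k)) = 0 by rewrite mulr0.
      have h c' : pev (mkpoint x ((s - (map_poly cid P).[x]) / x ^+ k)) (const
        c')
        = cid c' by exact: peval_const.
      rewrite [LHS](morph_beta_prod h) (morph_xS h) /= /pev !peval_var.
      rewrite mkpoint0 mkpoint1 skelK // xG.
      by apply/eqP; rewrite -[_ == 0]negbK betaprod_neq0 // negbK codom_f.
    have Sv : peval (skeleton k P) v = 0 by rewrite peval_skeleton.
    exact: (reducible_fiber_not_trivial oU Uc tU HAB
      (generic_fiber_paths (nf := nf2) ok2) Sv Bw).
  + move=> /eqP bv0.
    have : ~~ (betaprod cid beta a (gval cid nf2 (v 0 0) (v 0 1)) != 0).
      by rewrite negbK bv0.
    rewrite betaprod_neq0 // negbK => /codomP[i Gi].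
    have c0 : c = 0 by have /HE <- := Hv; rewrite /= bv0 mulr0.
    apply: (no_factor (const (beta i) - nf_G nf2) _ w1 _ _ Hv (H1 c0));
      rewrite ?GE ?Gi ?subrr //.
      by apply: congr_modM0; apply: congr_mod_beta_prod0.
    rewrite /= s1 -(ltn_predK q0) exprS mul0r mulr0 subr0; exact: b0.
- move=> [_ [_ _ a0] _] oU Uc tU ng Hv no_factor witness GE HE _.
  have [|w Hw] := witness; first by [].
  move: ng; rewrite /good negbK => /eqP b0; rewrite betaprod_neq0 // => bw.
  have : ~~ (betaprod cid beta a (v 0 0) != 0) by rewrite negbK b0.
  rewrite betaprod_neq0 // negbK => /codomP[i Gi].
  apply: (no_factor (const (beta i) - var R 0) _ w _ _ Hv Hw);
    rewrite ?pevalB ?peval_const ?peval_var ?Gi ?subrr //.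
    (* Modulo [beta i - x], the first term of [H] is 0 and the second is the constant
       [h(beta i)]. *)
    apply: congr_modD.
      by apply: congr_modM0; apply: congr_mod_beta_prod0.
    by apply: congr_mod_poly_in_x; apply: congr_mod_const_sub.
  by rewrite subr_eq0; apply: contraNneq bw => <-; apply: codom_f.
Qed.

End GenericGood.
(** * Line integrals *)

Section AlmostEverywhereIntegrals.
Variable R : realType.
Local Notation C := (Cplx R).

Definition cofinite_itv (F : seq R) : set R :=
  [set x | 0 < x < 1 /\ x \notin F].

Lemma open_cofinite_itv F : open (cofinite_itv F).
Proof.
have -> : cofinite_itv F = `]0, 1[%classic `&` ~` [set` F].
  by apply/seteqP; split => x /= []; rewrite in_itv /= => x01 /negP xF;
    split=> //;
    apply/negP.
apply: openI; first exact: interval_open.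
apply: closed_openC.
have [h _] := @accessible_finite_set_closed R; apply: h; last exact: finite_seq.
exact/hausdorff_accessible/norm_hausdorff.
Qed.

(** The exceptional points form a finite, hence null, set. Continuity of [f] elsewhere makes [f]
    measurable, and [g] as well since it coincides with [f] there. *)
Lemma Rintegral_eq_cofinite (F : seq R) (f g : R -> R) :
  (forall x, cofinite_itv F x -> {for x, continuous f}) ->
  (forall x, cofinite_itv F x -> f x = g x) ->
  \int[lebesgue_measure]_(x in `[0, 1]) f x
  = \int[lebesgue_measure]_(x in `[0, 1]) g x.
Proof.
move=> cf fg; set E := cofinite_itv F.
pose N := [set` 0 :: 1 :: F] `&` `[0, 1]%classic.
have fN : finite_set N by apply: finite_setIl; apply: finite_seq.
have m1 (A : set R) : finite_set A -> measurable A.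
  by move=> /finite_set_countable; apply: countable_measurable => t;
    apply: measurable_set1.
have mN : measurable N by exact: m1.
have mE : measurable E by apply: open_measurable; apply: open_cofinite_itv.
have DE : `[0, 1]%classic = E `|` N.
  apply/seteqP; split => x /=; rewrite in_itv /=.
    move=> /andP[x0 x1]; have [xF|xF] := boolP (x \in 0 :: 1 :: F).
      by right; split; rewrite //= in_itv /= x0 x1.
    move: xF; rewrite !inE !negb_or => /and3P[xn0 xn1 xF].
    by left; split=> //; rewrite !lt_neqAle eq_sym xn0 xn1 x0 x1.
  by case=> [[/andP[/ltW-> /ltW->]] //|[_]]; rewrite /= in_itv.
have mNf (h : R -> R) : measurable_fun N h.
  by move=> _ A _; apply: m1; apply: finite_setIl.
have mf : measurable_fun (E `|` N) f.
  apply/measurable_funU => //; split=> //.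
  apply: open_continuous_measurable_fun; first exact: open_cofinite_itv.
  by move=> x /set_mem; exact: cf.
have mg : measurable_fun (E `|` N) g.
  apply/measurable_funU => //; split=> //.
  apply: (@eq_measurable_fun _ _ _ _ _ f) => [x /set_mem|]; first exact: fg.
  by case: ((measurable_funU f mE mN).1 mf).
rewrite /Rintegral DE; congr fine; apply: ae_eq_integral => //;
  first exact: measurableU.
- exact/measurable_EFinP.
- exact/measurable_EFinP.
exists N; split=> //; first
  exact/countable_lebesgue_measure0/finite_set_countable.
move=> x /= nx; apply: contrapT => xN; apply: nx => -[Ex|//].
by rewrite fg.
Qed.

Lemma integral01_eq_cofinite (F : seq R) (f g : R -> C) :
  (forall x, cofinite_itv F x -> ccont f x) ->
  (forall x, cofinite_itv F x -> f x = g x) -> integral01 f = integral01 g.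
Proof.
move=> cf fg; rewrite /integral01; congr Complex;
  apply: (@Rintegral_eq_cofinite F) => x Ex; rewrite ?fg //.
  exact: (cf x Ex).1.
exact: (cf x Ex).2.
Qed.

End AlmostEverywhereIntegrals.

(** * Velocity of piecewise C1 curves *)

Section PiecewiseC1.
Variable R : realType.
Local Notation C := (Cplx R).

Lemma itv_partition_between (s : seq R) (a b x : R) : itv_partition a b s ->
  a < x < b -> x \notin s ->
  exists2 i, (i < size s)%N & nth 0 (a :: s) i < x < nth 0 s i.
Proof.
elim: s a => [|d s IHs] a ps /andP[ax xb].
  by move: ax xb; rewrite (itv_partition_nil ps) => bx /(lt_trans bx);
    rewrite ltxx.
rewrite inE negb_or => /andP[xd xs]; have [lxd|ldx] := ltP x d.
  by exists 0%N; rewrite //= ax.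
have [|i i_s ix] := IHs d (itv_partition_cons ps) _ xs.
  by rewrite lt_neqAle eq_sym xd ldx.
by exists i.+1.
Qed.

(** The exceptional set is the partition: near any other point of the open interval the curve is one
    of the C1 pieces, with velocity [w]. *)
Lemma piecewise_C1_locally (g : R -> plane R) : piecewise_C1 g ->
  exists F : seq R, forall x, cofinite_itv F x ->
    exists w : 'I_2 -> R -> C,
      (\forall t \near x, pder g t (fun j => w j t)) /\
      (forall j, ccont (w j) x).
Proof.
move=> [s [ps gs]]; exists s => x [x01 xs].
have [i i_s /andP[lx xr]] := itv_partition_between ps x01 xs.
have [h hC gh] := gs i i_s.
exists (fun j t => curve_derivative (fun t => h t 0 j) t); split.
  have : \forall t \near x, nth 0 (0 :: s) i < t < nth 0 s i.
    have xi : x \in `]nth 0 (0 :: s) i, nth 0 s i[ by rewrite in_itv /= lx.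
    by apply: filterS (near_in_itvoo xi) => t; rewrite in_itv.
  (* The derivative at a nearby [t] requires agreement of [g] and [h] on a whole neighbourhood of
     [t]. *)
  move=> /nbhs_interior; apply: filterS => t nt j.
  apply: (@near_cder _ (fun t => h t 0 j)).
    by apply: filterS nt => t' /andP[/ltW a /ltW b]; rewrite gh ?a.
  have [[dR _] [dI _]] := hC j.
  by split; rewrite /curve_derivative /= derive1E; apply: derivableP.
move=> j; have [[_ cR] [_ cI]] := hC j.
by split; [exact: cR|exact: cI].
Qed.

End PiecewiseC1.

(** * Transport of the integrals by the rectifying map *)

Section TransportedIntegrals.
Variables (R : realType) (nf : normal_form R).
Local Notation C := (Cplx R).
Local Notation cid := (idfun : C -> C).
Local Notation H := (nf_H nf).
Local Notation Rect := (rectifying_map nf).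
Hypothesis ok : nf_ok nf.

Definition rect_poly (i : 'I_2) : bipoly R := if i == 0 then nf_G nf else H.

Lemma rect_at (v : plane R) i : rvalue_at (Rect 0 i) v (peval (rect_poly i) v).
Proof. by rewrite mxE; apply: rvalue_at_tofrac. Qed.

Lemma map_value_rect (v : plane R) :
  map_value Rect v = mkpoint (gval cid nf (v 0 0) (v 0 1))
                             (hval cid nf (v 0 0) (v 0 1)).
Proof.
apply/rowP => i; rewrite mxE (rvalueE (rect_at v i)) [RHS]mxE /rect_poly.
by case: eqP => _; [exact: peval_nf_G|exact: peval_nf_H].
Qed.

Lemma rect_inv_at (v : plane R) : good cid nf (v 0 0) (v 0 1) ->
  forall i, rvalue_at (rect_inv nf 0 i) (map_value Rect v) (v 0 i).
Proof.
move=> gv i; rewrite map_value_rect.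
set u := mkpoint _ _; have := @rect_inv_value _ nf u.
rewrite mkpoint0 mkpoint1 => /(_ (good_tgood gv) i).
by have [-> ->] := invxyK ok gv; rewrite mkpointE.
Qed.

Lemma rvalue_at_psubst (Psi : ratmap R) (u w : plane R) (p : bipoly R) :
  (forall i, rvalue_at (Psi 0 i) u (w 0 i)) ->
  rvalue_at (psubst Psi p) u (peval p w).
Proof.
move=> Pw; elim/bipoly_ind: p => [c|i|p q IHp IHq|p q IHp IHq].
- by rewrite psubst_const peval_const; apply: rvalue_at_const.
- by rewrite psubst_var peval_var.
- by rewrite rmorphD pevalD; apply: rvalue_atD.
- by rewrite rmorphM pevalM; apply: rvalue_atM.
Qed.

Variable theta : 'rV[bipoly R]_2.
Let vartheta : ratform R := map_mx (fun p => tofrac p) theta.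
Let eta := form_pushforward Rect vartheta.

Lemma etaE j : eta 0 j =
  \sum_i psubst (rect_inv nf) (theta 0 i) * rderiv j (rect_inv nf 0 i).
Proof.
rewrite /eta /form_pushforward (ratinv_rect ok) /form_pullback summxE.
apply: eq_bigr => i _; rewrite [LHS]mxE [differential _ 0 j]mxE.
by congr (_ * _); rewrite mxE (rsubst_tofrac (rect_inv_dominant ok)).
Qed.

(** The coefficients of [eta] are built from polynomials in the components of the inverse and from
    their derivatives, all regular at the image of a good point. *)
Lemma eta_at (v : plane R) : good cid nf (v 0 0) (v 0 1) -> forall j,
  rvalue_at (eta 0 j) (map_value Rect v) (\sum_i peval (theta 0 i) v
    * rvalue (rderiv j (rect_inv nf 0 i)) (map_value Rect v)).
Proof.
move=> gv j; rewrite etaE.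
apply: (big_ind2 (fun f z => rvalue_at f (map_value Rect v) z)).
- by have := rvalue_at_const (map_value Rect v) 0; rewrite rmorph0.
- by move=> *; apply: rvalue_atD.
move=> i _; apply: rvalue_atM; first exact: rvalue_at_psubst (rect_inv_at gv).
by apply/regular_at_rvalue/regular_at_rderiv; exists (v 0 i);
  apply: rect_inv_at.
Qed.

Section Curve.
Variable g : R -> plane R.
Hypothesis g_good : forall s, 0 <= s <= 1 -> good cid nf (g s 0 0) (g s 0 1).
Let al s := map_value Rect (g s).

Let form_along (w : ratform R) (h : R -> plane R) (s : R) : C :=
  \sum_j rvalue (w 0 j) (h s) * curve_derivative (fun t => h t 0 j) s.

(** Near [x] the curve [g] is the inverse map applied to [al], so uniqueness of derivatives
    expresses [w] through the velocity [w'] of [al]. This avoids inverting a Jacobian matrix;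
    exchanging the two sums then gives the claim. *)
Lemma pullback_along x w : 0 < x < 1 -> pder g x w ->
  form_along vartheta g x = form_along eta al x.
Proof.
move=> x01 dg; have x01' : 0 <= x <= 1 by case/andP: x01 => /ltW -> /ltW ->.
pose w' i := \sum_j peval (mderiv j (rect_poly i)) (g x) * w j.
have dal : pder al x w'.
  move=> i; apply: (eq_cder _ (cder_peval (rect_poly i) dg)) => t.
  by rewrite mxE (rvalueE (rect_at _ i)).
have wE i : w i = \sum_j rvalue (rderiv j (rect_inv nf 0 i)) (al x) * w' j.
  have reg : regular_at (rect_inv nf 0 i) (al x).
    by exists (g x 0 i); apply: rect_inv_at; apply: g_good.
  apply: cder_uniq (dg i) _; apply: near_cder (cder_rvalue reg dal).
  (* Goodness is known on [[0, 1]] only, so a neighbourhood of [x] is taken inside the open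
     interval. *)
  have xi : x \in `]0, 1[ by rewrite in_itv.
  apply: filterS (near_in_itvoo xi) => t;
    rewrite in_itv /= => /andP[/ltW t0 /ltW t1].
  by apply/rvalueE/rect_inv_at/g_good; rewrite t0.
rewrite /form_along.
under eq_bigr => j _.
  rewrite mxE (rvalueE (rvalue_at_tofrac _ _)) (cder_curve_derivative (dg j))
    wE.
  rewrite mulr_sumr; over.
rewrite exchange_big /=; apply: eq_bigr => j _.
rewrite (rvalueE (eta_at (g_good x01') j)) (cder_curve_derivative (dal j)).
by rewrite mulr_suml; apply: eq_bigr => i _; rewrite mulrA.
Qed.

(** Continuity is checked on the source side, where the coefficients are polynomials; the integrand
    on the target side equals it off the partition points. *)
Lemma line_integral_rect : piecewise_C1 g ->
  line_integral g vartheta = line_integral al eta.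
Proof.
move=> /piecewise_C1_locally[F gF]; apply: (@integral01_eq_cofinite _ F).
  move=> x /gF[w [dw cw]]; have dgx := nbhs_singleton dw.
  apply: (@near_ccont _ (fun t => \sum_j peval (theta 0 j) (g t) * w j t)).
    apply: filterS dw => t dt; apply: eq_bigr => j _.
    by rewrite mxE (rvalueE (rvalue_at_tofrac _ _)) (cder_curve_derivative (dt
      j)).
  apply: (@eq_ccont _ (fun t => peval (theta 0 0) (g t) * w 0 t
    + peval (theta 0 1) (g t) * w 1 t)).
    move=> t; rewrite big_ord_recl big_ord1.
    by have -> : lift ord0 ord0 = 1 :> 'I_2 by apply/val_inj.
  by apply: ccontD; apply: ccontM => //; apply: ccont_peval;
    apply: pder_pcont dgx.
move=> x xF; have [w [dw _]] := gF x xF.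
exact: pullback_along xF.1 (nbhs_singleton dw).
Qed.

End Curve.

End TransportedIntegrals.

(** Being an isolated zero and having a given order there constrain the function only through its
    values on [D], apart from the value at the zero itself, which for isolated zeros lies in [D]. *)
Lemma zero_count_eq (R : realType) (D : set (Cplx R)) (f g : Cplx R -> Cplx R) :
  (forall c, D c -> f c = g c) -> zero_count D f = zero_count D g.
Proof.
move=> fg; have zE : isolated_zero D f = isolated_zero D g.
  apply/funext => z; apply/propext; split=> -[Dz z0 nz]; split=> //.
  - by rewrite -fg.
  - by apply: filterS nz => w h Dw; rewrite -fg // h.
  - by rewrite fg.
  - by apply: filterS nz => w h Dw; rewrite fg // h.
have mE : multiplicity D f = multiplicity D g.
  apply/funext => z; congr xget; apply/funext => n; apply/propext.
  by split=> -[k [k1 k2 k3]]; exists k; split=> //; apply: filterS k3 => w h Dw;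
    rewrite -h // fg.
by rewrite /zero_count zE mE.
Qed.

Theorem corollary15 (R : realType) (nf : normal_form R)
    (theta : 'rV[bipoly R]_2) (delta : Cplx R -> R -> plane R) :
  nf_ok nf ->
  let H := nf_H nf in
  let Rect := rectifying_map nf in
  let vartheta : ratform R := map_mx (fun p => tofrac p) theta in
  let eta : ratform R := form_pushforward Rect vartheta in
  (birational Rect /\
   forall eps : Cplx R,
     form_pushforward Rect
       (differential (tofrac H) + tofrac (const eps) *: vartheta)
     = differential (tofrac (var R 1)) + tofrac (const eps) *: eta)
  /\
  (family_of_cycles H delta ->
   let D : set (Cplx R) := ~` (bifurcation_set H `|` contracted_values nf) in
   let alpha := fun (c : Cplx R) (s : R) => map_value Rect (delta c s) in
   let I := fun c : Cplx R => line_integral (delta c) vartheta in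
   let J := fun c : Cplx R => line_integral (alpha c) eta in
   [/\ forall c s, D c -> 0 <= s <= 1 -> all_regular_at eta (alpha c s),
       rationally_equivalent_integrals D H delta vartheta (var R 1) alpha eta,
       forall c, D c -> I c = J c
     & zero_count D I = zero_count D J]).
Proof.
move=> ok H Rect vartheta eta; split.
  split; first by exists (rect_inv nf); apply: rect_invP.
  by move=> eps; apply: pushforward_perturbed.
move=> [cycles _] D alpha I J.
have D_loop c : D c -> closed_loop_in (fiber H c) (delta c).
  by move=> Dc; case: (cycles c) => // Bc; apply: Dc; left.
have D_good c s : D c -> 0 <= s <= 1 ->
    good (idfun : Cplx R -> Cplx R) nf (delta c s 0 0) (delta c s 0 1).
  move=> Dc s01; have [_ _ Hd] := D_loop c Dc.
  by apply: (@generic_good _ nf ok c) => [Bc|Kc|];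
    [apply: Dc; left|apply: Dc; right|apply: Hd].
have IJ c : D c -> I c = J c.
  move=> Dc; have [pC1 _ _] := D_loop c Dc.
  by apply: line_integral_rect pC1 => // s s01; apply: D_good.
split; [| |exact: IJ|exact: zero_count_eq IJ].
- by move=> c s Dc s01 j; eexists; apply: eta_at => //; apply: D_good.
(* The rectifying map itself realizes the equivalence; its inverse is regular along the image cycles
   because the original cycles consist of good points. *)
exists Rect; split.
- by exists (rect_inv nf); apply: rect_invP.
- by rewrite (rsubst_tofrac (rect_dominant ok)) psubst_var mxE.
- by [].
move=> c s Dc s01; split=> [i||i]; [|by []|].
  by eexists; apply: rect_at.
rewrite (ratinv_rect ok); eexists; apply: rect_inv_at => //; exact: D_good.
Qed.
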